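(* Let $m\ge 1$, let $p>m$ be a prime, and let $\mathcal{F}=\{f_0,\ldots,f_m\}\subset\mathbb{F}_p[X_0,\ldots,X_m]$ be a family of $m+1$ polynomials of total degree $d\ge 2$ of the form $$f_i=X_i\,g_i(X_{i+1},\ldots,X_m)+h_i(X_{i+1},\ldots,X_m)\quad (i=0,\ldots,m-1),\qquad f_m=aX_m+b,$$ where $a,b\in\mathbb{F}_p$, $a\neq 0$, $g_i,h_i\in\mathbb{F}_p[X_{i+1},\ldots,X_m]$, and for each $i=0,\ldots,m-1$ $$g_i=X_{i+1}^{s_{i,i+1}}\cdots X_m^{s_{i,m}}+\widetilde{g}_i(X_{i+1},\ldots,X_m),\qquad \deg\widetilde{g}_i<\deg g_i=s_{i,i+1}+\cdots+s_{i,m},\qquad \deg h_i\le\deg g_i,$$ with nonnegative integers $s_{i,j}$ and $\widetilde g_i\in\mathbb{F}_p[X_{i+1},\ldots,X_m]$, and such that $s_{0,1}s_{1,2}\cdots s_{m-1,m}\neq 0$. Let the sequence $\{\mathbf{u}_n\}$ be generated by $\mathcal{F}$ from some initial values $u_{0,0},\ldots,u_{0,m}$ (see context), and assume that it is purely periodic with period $T$. Then for any fixed integer $\nu\ge 1$ and any positive integer $N\le T$, the discrepancy $D_N$ of the sequence $$\left(\frac{u_{n,0}}{p},\ldots,\frac{u_{n,m-1}}{p}\right),\qquad n=0,\ldots,N-1,$$ satisfies the bound $$D_N=O\left(p^{\alpha_{m,\nu}}N^{-\beta_{m,\nu}}(\log p)^m\right),$$ where $$\alpha_{m,\nu}=\frac{2m^2+2m\nu+2m+\nu}{4\nu(m+\nu)}\qquad\text{and}\qquad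 \beta_{m,\nu}=\frac{1}{2\nu},$$ and the implied constant depends only on $d$, $m$ and $\nu$.
   Context: $\deg$ denotes total degree, and the zero polynomial has degree $-\infty$; the total degree of the family $\mathcal{F}$ is the largest total degree of its members. Elements of $\mathbb{F}_p$ are identified with the integers $0,\ldots,p-1$. Given initial values $u_{0,0},\ldots,u_{0,m}\in\{0,\ldots,p-1\}$, define $$u_{n+1,i}\equiv f_i(u_{n,0},\ldots,u_{n,m})\pmod p,\qquad 0\le u_{n+1,i}<p,\qquad i=0,\ldots,m,\ n=0,1,\ldots.$$ Put $\mathbf{w}_n=(u_{n,0},\ldots,u_{n,m})$ and $\mathbf{u}_n=(u_{n,0},\ldots,u_{n,m-1})$ (the last component is discarded). ''Purely periodic with period $T$'' means that $T$ is the least positive integer with $\mathbf{w}_{n+T}=\mathbf{w}_n$ for all $n\ge 0$ (so also $\mathbf{u}_{n+T}=\mathbf{u}_n$ for all $n\ge 0$). The discrepancy of a sequence $\Gamma$ of $N$ points in $[0,1)^m$ is $$\Delta(\Gamma)=\sup_{B\subseteq[0,1)^m}\left|\frac{T_\Gamma(B)}{N}-|B|\right|,$$ where the supremum is over all boxes $B=[\alpha_1,\beta_1)\times\cdots\times[\alpha_m,\beta_m)\subseteq[0,1)^m$, $|B|$ is the volume of $B$, and $T_\Gamma(B)$ is the number of points of $\Gamma$ (counted with multiplicity) inside $B$. *)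

(* Defs.v *)
From HB Require Import structures.
From mathcomp Require Import all_boot all_order all_algebra.
From mathcomp Require Import all_classical all_reals all_analysis.
(* Its notations clash with those of MathComp-Analysis. *)
From mathcomp Require mpoly.
Import -(notations) mpoly.

Set Implicit Arguments.
Unset Strict Implicit.
Unset Printing Implicit Defensive.

Import Order.TTheory GRing.Theory Num.Theory.
Local Open Scope classical_set_scope.
Local Open Scope ring_scope.

Notation mpolys n R := (mpoly.mpoly n R).
Notation mvar i := (mpoly.mpolyX _ (mpoly.mnm1 i)).
Notation mconst c := (mpoly.mpolyC _ c).

(* One plus the total degree, and 0 for the zero polynomial: comparing sizes
   amounts to comparing total degrees with the convention deg 0 = -oo. *)
Notation msize q := (mpoly.mmeasure mpoly.mdeg q).

(* q is a polynomial in the variables X_(i+1), X_(i+2), ... only *)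
Definition in_vars_above (R : nzRingType) (n : nat) (i : 'I_n)
    (q : mpolys n R) : Prop :=
  forall mu, mu \in mpoly.msupp q -> forall j : 'I_n, (j <= i)%N -> mu j = 0%N.

(* The values at index m of g, h and gtil, and those of s i j for j <= i or
   m < j, play no role. *)
Definition triangular_family (F : fieldType) (m : nat)
    (f : 'I_m.+1 -> mpolys m.+1 F) : Prop :=
  exists (a b : F) (g h gtil : 'I_m.+1 -> mpolys m.+1 F) (s : nat -> nat -> nat),
  [/\ a != 0,
      f ord_max = a *: mvar ord_max + mconst b,
      (\prod_(i < m) s i i.+1 != 0)%N
    & forall i : 'I_m.+1, (i < m)%N ->
      [/\ [/\ in_vars_above i (g i), in_vars_above i (h i)
            & in_vars_above i (gtil i)],
          f i = mvar i * g i + h i,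
          g i = \prod_(j < m.+1 | (i < j)%N) mvar j ^+ s i j + gtil i,
          (msize (gtil i) < msize (g i))%N /\
          msize (g i) = (\sum_(j < m.+1 | i < j) s i j).+1%N
        & (msize (h i) <= msize (g i))%N]].

Definition family_degree (F : fieldType) (n k : nat)
    (f : 'I_k -> mpolys n F) (d : nat) : Prop :=
  (\max_(i < k) msize (f i) = d.+1)%N.

Definition next_state (F : fieldType) (n : nat) (f : 'I_n -> mpolys n F)
    (w : {ffun 'I_n -> F}) : {ffun 'I_n -> F} :=
  [ffun i => meval w (f i)].

(* w_0 = w0, w_(n+1) = (f_0(w_n), f_1(w_n), ...) *)
Definition orbit_seq (F : fieldType) (n : nat) (f : 'I_n -> mpolys n F)
    (w0 : {ffun 'I_n -> F}) (k : nat) : {ffun 'I_n -> F} :=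
  iter k (next_state f) w0.

Definition purely_periodic (A : Type) (w : nat -> A) (T : nat) : Prop :=
  [/\ (0 < T)%N,
      forall n, w (n + T)%N = w n
    & forall T', (0 < T')%N -> (forall n, w (n + T')%N = w n) -> (T <= T')%N].

Section Discrepancy.
Context {R : realType} {m : nat}.
Implicit Types al be x : 'rV[R]_m.

Definition box al be : pred 'rV[R]_m :=
  fun x => [forall i, al 0 i <= x 0 i < be 0 i].

Definition unit_subbox al be : Prop :=
  forall i, [/\ 0 <= al 0 i, al 0 i <= be 0 i & be 0 i <= 1].

Definition box_volume al be : R := \prod_(i < m) (be 0 i - al 0 i).

Definition local_discrepancy (N : nat) (Gamma : 'I_N -> 'rV[R]_m) al be : R :=
  `| #|[pred n : 'I_N | box al be (Gamma n)]|%:R / N%:R - box_volume al be |.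

Definition local_discrepancies (N : nat) (Gamma : 'I_N -> 'rV[R]_m) : set R :=
  [set r | exists al be, unit_subbox al be /\ r = local_discrepancy Gamma al be].

Definition discrepancy (N : nat) (Gamma : 'I_N -> 'rV[R]_m) : R :=
  sup (local_discrepancies Gamma).

(* so that the real-valued [sup] above is a genuine supremum *)
Lemma has_sup_local_discrepancies (N : nat) (Gamma : 'I_N -> 'rV[R]_m) :
  has_sup (local_discrepancies Gamma).
Proof.
split.
  exists (local_discrepancy Gamma 0 0), 0, 0; split => // i.
  by rewrite !mxE lexx ler01.
exists 1 => _ [al [be [ab ->]]].
have v01 : 0 <= box_volume al be <= 1.
  apply/andP; split.
    by apply: prodr_ge0 => i _; rewrite subr_ge0; case: (ab i).
  apply: prodr_ile1 => i; case: (ab i) => a0 lab b1 _.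
  by rewrite subr_ge0 lab /= lerBlDr (le_trans b1)// lerDl.
rewrite /local_discrepancy; set k := #|_|.
have c0 : 0 <= k%:R / N%:R :> R by rewrite divr_ge0 // ler0n.
have c1 : k%:R / N%:R <= 1 :> R.
  have kN : (k <= N)%N by rewrite (leq_trans (max_card _)) // card_ord.
  have [N0|N0] := eqVneq N 0%N; first by rewrite (_ : N%:R = 0) ?N0 // invr0 mulr0 ler01.
  by rewrite ler_pdivrMr ?ltr0n ?lt0n // mul1r ler_nat.
case/andP: v01 => v0 v1.
rewrite ler_norml; apply/andP; split.
  by rewrite lerBrDr (le_trans _ c0) // addrC subr_le0.
by rewrite lerBlDr (le_trans c1) // lerDl.
Qed.

End Discrepancy.

(* The point (u_(n,0)/p, ..., u_(n,m-1)/p), the last coordinate being dropped;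
   for p prime, the coercion 'F_p -> nat gives the representative in
   {0, ..., p-1}. *)
Definition scaled_point (R : realType) (p m : nat)
    (w : {ffun 'I_m.+1 -> 'F_p}) : 'rV[R]_m :=
  \row_(i < m) ((w (widen_ord (leqnSn m) i) : nat)%:R / p%:R).

Definition alpha_exp (R : realType) (m nu : nat) : R :=
  (2 * m ^ 2 + 2 * m * nu + 2 * m + nu)%:R / (4 * nu * (m + nu))%:R.

Definition beta_exp (R : realType) (nu : nat) : R := (2 * nu%:R)^-1.

(* Main.v *)
Require Import Defs.
From HB Require Import structures.
From mathcomp Require Import all_boot all_order all_algebra.
From mathcomp Require Import all_classical all_reals all_analysis.
From mathcomp Require Import complex.
From mathcomp Require mpoly.
Import -(notations) mpoly.
From mathcomp Require Import zify ring lra.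

(** Expanding the indicators of the m integer intervals that make up a box into
additive characters of F_p reduces the discrepancy to exponential sums; it costs
a factor O(log p) for each coordinate, because the Fourier coefficients of an
interval sum to O(log p) in absolute value ([discrepancy_le]). So for each
nonzero linear form [a] in the first m coordinates the sum S of e(a.w_n) over
n < N has to be O(N) times p^alpha N^(-beta), where e is the standard character
and w_n the orbit of the map Phi given by the family.

For every K, averaging over the shifts of n by k < K gives K |S| <= W + 2 K^2,
where W is the sum over n < N of the absolute values of the inner sums of
e(a.w_(n+k)) over k < K. By the power mean inequality W^(2 nu) is at most
N^(2 nu - 1) times the sum of the 2 nu-th powers of the inner sums. As N is at
most the period, the states w_n with n < N are distinct, and this sum only grows
when n < N is replaced by all states w ([sum_orbit_le]). Expanding the power
leads to sums over w of e(L(w)), where L(w) is a linear combination of the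
a.Phi^k(w) with coefficients r_k. The terms with r = 0 come from the pairs of
nu-tuples of exponents k that agree up to order, if p > nu; they contribute
O(K^nu p^(m+1)).

Let s be the first index with a_s nonzero, and let r be nonzero. The s-th
component of Phi^k is affine in the s-th coordinate; its slope is the product of
the values of g_s along the orbit. Hence on a line in direction s the character
sum vanishes unless the corresponding combination of slopes is zero
([norm_character_sum]), and states with that property are rare: on a line in
direction s + 1 the slopes are partial products of nonconstant polynomials in
one variable, which have increasing degrees and are therefore linearly
independent, so at most d K states of the line have the property
([card_slope_relation]). This holds as long as the orbits avoid, for K steps,
the set E of the states at which some g_i or its derivative with respect to
X_(i+1) vanishes. By the bound of Schwartz and Zippel E has O(p^m) elements.
Moreover Phi is injective off E, whence at most K #|E| states have an orbit that visits E
within K steps ([card_hits]). So each such sum is O(K p^m).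

With K the integer part of p^(1/(2(m+nu))) the second contribution,
O(K^(2 nu + 1) p^m), does not exceed the order of the first, and the bound for S
follows ([orbit_sum_le]). The primes p <= max(d, nu) are covered by |S| <= N,
because p^alpha N^(-beta) is at least 1/p for N <= p^(m+1). *)

Set Implicit Arguments.
Unset Strict Implicit.
Unset Printing Implicit Defensive.

Import Order.TTheory GRing.Theory Num.Theory.
Import ComplexField.Normc.
Local Open Scope ring_scope.

(** * Counting along lines *)

Lemma card_le_fibres (T U : finType) (f : T -> U) (A : {set T}) (B : {set U}) D :
  {in A, forall x, f x \in B} ->
  (forall u, u \in B -> #|[set x in A | f x == u]| <= D)%N ->
  (#|A| <= D * #|B|)%N.
Proof.
move=> fAB fib; rewrite -sum1_card (partition_big f (mem B)) //=.
rewrite mulnC -sum_nat_const; apply: leq_sum => u uB.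
by rewrite sum1dep_card; apply: fib.
Qed.

(** Lines in a coordinate direction are parametrized by translations, so that
sums over the points of a line are sums over bijections of the states. *)
Definition shift (F : finFieldType) (n : nat) (j : 'I_n) (x : F)
    (w : {ffun 'I_n -> F}) : {ffun 'I_n -> F} :=
  [ffun i => w i + (if i == j then x else 0)].

(** The lines in direction j are indexed by the other coordinates. *)
Lemma card_le_lines (F : finFieldType) (n : nat) (j : 'I_n.+1)
    (A : {set {ffun 'I_n.+1 -> F}}) D :
  {in A, forall w, #|[set x | shift j x w \in A]| <= D}%N ->
  (#|A| <= D * #|F| ^ n)%N.
Proof.
move=> lineA; pose rest (w : {ffun 'I_n.+1 -> F}) := [ffun i => w (lift j i)].
have -> : (#|F| ^ n)%N = #|[set: {ffun 'I_n -> F}]|.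
  by rewrite cardsT card_ffun card_ord.
apply: (@card_le_fibres _ _ rest) => [w _|u _]; first exact: finset.in_setT.
set L := [set w in A | _]; have [->|[w0 w0L]] := set_0Vmem L.
  by rewrite cards0.
have /[!inE] /andP[w0A /eqP w0u] := w0L.
apply: leq_trans (lineA _ w0A).
have inj : {in L &, injective (fun w : {ffun _ -> _} => w j - w0 j)}.
  move=> w w' /[!inE] /andP[_ /eqP wu] /andP[_ /eqP wu'] /addIr wj.
  apply/ffunP => i; case: (unliftP j i) => [k ->|->] //.
  by move: wu; rewrite -wu' => /ffunP /(_ k); rewrite !ffunE.
rewrite -(card_in_imset inj); apply: subset_leq_card.
apply/fintype.subsetP => _ /imsetP[w wL ->]; rewrite inE.
suff -> : shift j (w j - w0 j) w0 = w by move: wL; rewrite inE => /andP[].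
move: wL; rewrite inE => /andP[_ /eqP wu].
apply/ffunP => i; rewrite ffunE; case: (unliftP j i) => [k ->|->].
  rewrite eq_sym (negPf (neq_lift j k)) addr0.
  by move: wu; rewrite -w0u => /ffunP /(_ k); rewrite !ffunE.
by rewrite eqxx addrC subrK.
Qed.

(** * Zeros of polynomials in several variables *)

Section SchwartzZippel.
Variable F : finFieldType.

Definition zeros (n : nat) (q : mpolys n F) : {set {ffun 'I_n -> F}} :=
  [set w : {ffun _ -> _} | meval w q == 0].

Definition drop_last (n : nat) (mu : multinom n.+1) : multinom n :=
  Multinom [tuple mu (widen_ord (leqnSn n) i) | i < n].

(** The coefficients of q as a polynomial in its last variable. *)
Definition last_coef (n : nat) (q : mpolys n.+1 F) (t : nat) : mpolys n F :=
  \sum_(mu <- msupp q | mu ord_max == t) mcoeff mu q *: mpolyX F (drop_last mu).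

Lemma mdeg_drop_last n (mu : multinom n.+1) :
  (mdeg (drop_last mu) + mu ord_max = mdeg mu)%N.
Proof.
rewrite !mdegE big_ord_recr /=; congr (_ + _)%N.
by apply: eq_bigr => i _; rewrite mnmE.
Qed.

Lemma msize_last_coef n (q : mpolys n.+1 F) t :
  (msize (last_coef q t) <= msize q)%N.
Proof.
apply: leq_trans (mmeasure_sum _ _ _ _) _.
rewrite big_seq_cond; apply/bigmax_leqP_seq => mu _ /andP[mu_q _].
apply: leq_trans (mmeasureZ_le _ _ _) _; rewrite mmeasureX.
apply: leq_ltn_trans (msize_mdeg_lt mu_q).
by rewrite -(mdeg_drop_last mu) leq_addr.
Qed.

Lemma drop_last_inj n (mu mu' : multinom n.+1) :
  mu ord_max = mu' ord_max -> drop_last mu = drop_last mu' -> mu = mu'.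
Proof.
move=> emax erest; apply/mnmP => i.
have [k ik|->] := unliftP ord_max i; last by [].
have -> : i = widen_ord (leqnSn n) k.
  by apply: val_inj; rewrite ik /= /bump leqNgt ltn_ord.
by have := congr1 (fun mu : multinom n => mu k) erest; rewrite !mnmE.
Qed.

Lemma mcoeff_last_coef n (q : mpolys n.+1 F) (mu : multinom n.+1) :
  mu \in msupp q ->
  mcoeff (drop_last mu) (last_coef q (mu ord_max)) = mcoeff mu q.
Proof.
move=> mu_q; rewrite /last_coef raddf_sum /= big_mkcond (bigD1_seq mu) ?msupp_uniq //= eqxx.
rewrite mcoeffZ mcoeffX eqxx mulr1 big1_seq ?addr0 // => nu /andP[nu_mu _].
case: eqP => // e; rewrite mcoeffZ mcoeffX.
case: eqP => [e'|]; last by rewrite mulr0.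
by rewrite (drop_last_inj e e') eqxx in nu_mu.
Qed.

Lemma meval_last_coef n (q : mpolys n.+1 F) (w : {ffun 'I_n.+1 -> F}) :
  meval w q =
  (\poly_(t < msize q)
     meval (fun i => w (widen_ord (leqnSn n) i)) (last_coef q t)).[w ord_max].
Proof.
rewrite horner_poly mevalE.
transitivity (\sum_(mu <- msupp q) \sum_(t < msize q | mu ord_max == t :> nat)
   mcoeff mu q * \prod_(i < n) w (widen_ord (leqnSn n) i) ^+ drop_last mu i
    * w ord_max ^+ t); last first.
  rewrite (exchange_big_dep xpredT) //=; apply: eq_bigr => t _.
  rewrite /last_coef raddf_sum /= mulr_suml.
  by apply: eq_bigr => mu _; rewrite mevalZ mevalX.
rewrite big_seq [RHS]big_seq; apply: eq_bigr => mu mu_q.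
have lt_mu : (mu ord_max < msize q)%N.
  apply: leq_ltn_trans (msize_mdeg_lt mu_q).
  by rewrite -(mdeg_drop_last mu) leq_addl.
rewrite (big_pred1 (Ordinal lt_mu)) /=; last first.
  by move=> t; rewrite /= eq_sym.
rewrite big_ord_recr /= mulrA; congr (_ * _ * _).
by apply: eq_bigr => i _; rewrite mnmE.
Qed.

(** Induction on the number of variables: where a nonzero coefficient with
respect to the last variable does not vanish, at most deg q values of the last
variable give a zero. This is the bound of Schwartz and Zippel, up to the
factor n. *)
Lemma card_zeros n (q : mpolys n F) : q != 0 ->
  (#|zeros q| * #|F| <= n * msize q * #|F| ^ n)%N.
Proof.
elim: n q => [|n IHn] q q_neq0.
  rewrite (_ : zeros q = finset.set0) ?cards0 //; apply/finset.setP => w; rewrite !inE.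
  have cst : msize q = 1%N.
    rewrite -(mlead_deg q_neq0); congr _.+1.
    by rewrite mdegE big_ord0.
  have /msize_poly1P[c c0 ->] : msize q == 1%N by rewrite cst.
  by rewrite mevalC (negPf c0).
have mu_q := mlead_supp q_neq0; set mu := mlead q in mu_q.
pose c := last_coef q (mu ord_max).
have c_neq0 : c != 0.
  apply: contraTneq mu_q => c0; rewrite mcoeff_msupp -mcoeff_last_coef //.
    by rewrite -/c c0 mcoeff0 eqxx.
  exact: mlead_supp.
pose rest (w : {ffun 'I_n.+1 -> F}) := [ffun i => w (widen_ord (leqnSn n) i)].
pose line w := \poly_(t < msize q)
  meval (fun i => (w : {ffun 'I_n.+1 -> F}) (widen_ord (leqnSn n) i))
    (last_coef q t).
have rest_inj w w' : rest w = rest w' -> w ord_max = w' ord_max -> w = w'.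
  move=> ew emax; apply/ffunP => i.
  have [k ik|->] := unliftP ord_max i; last by [].
  have -> : i = widen_ord (leqnSn n) k.
    by apply: val_inj; rewrite ik /= /bump leqNgt ltn_ord.
  by have := congr1 (fun u : {ffun 'I_n -> F} => u k) ew; rewrite !ffunE.
have rest_shift w x : rest (shift ord_max x w) = rest w.
  apply/ffunP => i; rewrite !ffunE ifN ?addr0 //.
  by rewrite -val_eqE /= neq_ltn ltn_ord.
pose Z1 := [set w | rest w \in zeros c].
pose Z2 := [set w in zeros q | rest w \notin zeros c].
have le1 : (#|Z1| <= #|F| * #|zeros c|)%N.
  apply: (@card_le_fibres _ _ rest) => [w|u _]; first by rewrite inE.
  set L := [set _ in _ | _].
  have inj : {in L &, injective (fun w : {ffun 'I_n.+1 -> F} => w ord_max)}.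
    move=> w w'; rewrite !inE => /andP[_ /eqP wu] /andP[_ /eqP wu'].
    by apply: rest_inj; rewrite wu wu'.
  by rewrite -(card_in_imset inj); apply: max_card.
have le2 : (#|Z2| <= msize q * #|F| ^ n)%N.
  apply: (@card_le_lines _ _ ord_max) => w0; rewrite !inE => /andP[_ nz].
  have lineE w : rest w = rest w0 -> meval w q = (line w0).[w ord_max].
    move=> e; rewrite meval_last_coef; congr (horner _ _).
    rewrite /line; apply/polyP => t; rewrite !coef_poly; case: ifP => // _.
    apply: meval_eq => i.
    by have := congr1 (fun u : {ffun 'I_n -> F} => u i) e; rewrite !ffunE.
  have line_neq0 : line w0 != 0.
    apply: contraNneq nz => l0; apply/eqP.
    have := congr1 (fun p : {poly F} => p`_(mu ord_max)) l0.
    rewrite /= coef_poly coef0 ifT => [<-|].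
      by apply: meval_eq => i; rewrite ffunE.
    apply: leq_ltn_trans (msize_mdeg_lt mu_q).
    by rewrite -(mdeg_drop_last mu) leq_addl.
  apply: leq_trans (size_poly (msize q) (fun t => meval
     (fun i => w0 (widen_ord (leqnSn n) i)) (last_coef q t))).
  rewrite -/(line w0).
  pose rs := [seq w0 ord_max + x | x <- enum
     [set x | shift ord_max x w0 \in Z2]].
  have := @max_poly_roots _ (line w0) rs line_neq0.
  rewrite size_map -cardE => szr; apply/ltnW/szr.
    apply/allP => y /mapP[x]; rewrite mem_enum !inE => /andP[zx _] ->.
    rewrite /root -[X in _ == X](eqP zx) (lineE _ (rest_shift _ _)).
    by rewrite ffunE eqxx.
  by rewrite map_inj_uniq ?enum_uniq //; apply: addrI.
have le12 : (#|zeros q| <= #|Z1| + #|Z2|)%N.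
  apply: leq_trans (leq_card_setU Z1 Z2).1; apply/subset_leq_card/fintype.subsetP => w wq.
  rewrite finset.in_setU [w \in Z1]inE [w \in Z2]inE wq /=.
  by case: (rest w \in zeros c).
have le3 := IHn c c_neq0; have le4 : (msize c <= msize q)%N by exact: msize_last_coef.
apply: leq_trans (leq_mul le12 (leqnn _)) _.
rewrite mulnDl expnS.
have le5 : (#|zeros c| * #|F| <= n * msize q * #|F| ^ n)%N.
  by apply: leq_trans le3 _; rewrite !leq_mul.
have -> : (n.+1 * msize q * (#|F| * #|F| ^ n) =
  #|F| * (n * msize q * #|F| ^ n) + msize q * #|F| ^ n * #|F|)%N.
  by rewrite mulSn; ring.
apply: leq_add; last by rewrite leq_mul2r le2 orbT.
apply: leq_trans (leq_mul le1 (leqnn _)) _.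
by rewrite -mulnA leq_mul2l le5 orbT.
Qed.
End SchwartzZippel.

(** * Restriction of a polynomial to a line *)

Section LinePolynomial.
Variables (F : finFieldType) (n : nat) (j : 'I_n).

(** The restriction of g to the line through w in direction j; 'X is the
displacement from w, see [horner_line_poly]. *)
Definition line_poly (w : {ffun 'I_n -> F}) (g : mpolys n F) : {poly F} :=
  mmap polyC (fun i => (w i)%:P + (if i == j then 'X else 0)) g.

Lemma horner_line_poly w g x : (line_poly w g).[x] = meval (shift j x w) g.
Proof.
rewrite /line_poly mevalE /mmap horner_sum; apply: eq_bigr => mu _.
rewrite hornerM hornerC /mmap1 horner_prod; congr (_ * _).
apply: eq_bigr => i _; rewrite horner_exp hornerD hornerC ffunE.
by case: (i == j); rewrite ?hornerX ?horner0.
Qed.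

Lemma size_line_poly w g : (size (line_poly w g) <= msize g)%N.
Proof.
rewrite /line_poly /mmap; apply: leq_trans (size_sum _ _ _) _.
rewrite big_seq_cond; apply/bigmax_leqP_seq => mu _ /andP[mu_g _].
apply: leq_trans (msize_mdeg_lt mu_g).
rewrite mul_polyC; apply: leq_trans (size_scale_leq _ _) _.
rewrite /mmap1 mdegE; elim/big_ind2: _ => [|p a q b pa qb|i _].
- by rewrite size_poly1.
- apply: leq_trans (size_polyMleq _ _) _; move: pa qb; lia.
apply: leq_trans (size_poly_exp_leq _ _) _; rewrite ltnS.
set p := (_ + _); have : (size p <= 2)%N.
  apply: leq_trans (size_polyD _ _) _; rewrite geq_max.
  rewrite (leq_trans (size_polyC_leq1 _)) //.
  by case: ifP; rewrite ?size_polyX ?size_poly0.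
by move=> sp; rewrite -{2}(mul1n (mu i)) leq_mul2r; apply/orP; right; lia.
Qed.

Lemma deriv_line_poly w g : (line_poly w g)^`() = line_poly w (mderiv j g).
Proof.
elim/mpolyind: g => [|c mu p _ _ IHp].
  by rewrite mderiv0 /line_poly mmap0 deriv0.
rewrite mderivD /line_poly !mmapD derivD -!/(line_poly _ _) IHp; congr (_ + _).
rewrite mderivZ mderivX /line_poly !mmapZ !mmapX derivM derivC mul0r add0r.
suff -> : (mmap1 (fun i => (w i)%:P + (if i == j then 'X else 0)) mu)^`() =
   ((mu j)%:R)%:P *
   mmap1 (fun i => (w i)%:P + (if i == j then 'X else 0)) (mnm_sub mu (mnm1 j)).
  by [].
have off_j (nu : multinom n) :
    \prod_(i < n | i != j) ((w i)%:P + (if i == j then 'X else 0)) ^+ nu i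
    = (\prod_(i < n | i != j) w i ^+ nu i)%:P.
  rewrite rmorph_prod /=; apply: eq_bigr => i ij.
  by rewrite (negPf ij) addr0 rmorphXn.
have e : \prod_(i < n | i != j) w i ^+ mnm_sub mu (mnm1 j) i =
    \prod_(i < n | i != j) w i ^+ mu i.
  apply: eq_bigr => i ij; congr (_ ^+ _).
  by rewrite mnmBE mnm1E eq_sym (negPf ij) subn0.
rewrite /mmap1 !(bigD1 j (P := xpredT)) //= eqxx !off_j e.
rewrite derivM derivC mulr0 addr0 mnmBE mnm1E eqxx subn1.
rewrite deriv_exp derivD derivC derivX add0r mul1r.
by rewrite polyC_natr mulrA mulr_natl.
Qed.

(** So the lines on which g is constant lie in the zero set of a partial
derivative, which is a polynomial of no larger degree. *)
Lemma line_poly_constant w g :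
  (size (line_poly w g) <= 1)%N -> meval w (mderiv j g) = 0.
Proof.
move=> /size1_polyC e.
have := congr1 (fun p => p^`().[0]) e; rewrite /= derivC horner0.
rewrite deriv_line_poly horner_line_poly => <-.
by apply: meval_eq => i; rewrite ffunE; case: ifP; rewrite addr0.
Qed.

Lemma msize_mderiv (g : mpolys n F) : (msize (mderiv j g) <= msize g)%N.
Proof.
rewrite [in X in (X <= _)%N]msizeE; apply/bigmax_leqP_seq => mu mu_g _.
move: mu_g; rewrite mcoeff_msupp mcoeff_deriv => nz.
have : mnm_add mu (mnm1 j) \in msupp g.
  by rewrite mcoeff_msupp; apply: contraNneq nz => ->; rewrite mul0rn.
by move/msize_mdeg_lt; rewrite mdegD mdeg1; lia.
Qed.

End LinePolynomial.

(** The partial products of nonconstant polynomials have increasing degrees, so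
they are linearly independent; the proof is a Horner scheme. *)
Lemma sum_partial_products_neq0 (F : fieldType) (K : nat) (r : nat -> F)
    (Q : nat -> {poly F}) :
  (forall t, (t < K)%N -> (1 < size (Q t))%N) ->
  (exists2 k, (k < K)%N & r k != 0) ->
  \sum_(k < K) r k *: \prod_(t < k) Q t != 0.
Proof.
elim: K r Q => [|K IHK] r Q Q_gt1 [k kK rk]; first by [].
rewrite big_ord_recl big_ord0.
pose S := \sum_(k < K) r k.+1 *: \prod_(t < k) Q t.+1.
have -> : \sum_(i < K) r (lift ord0 i) *: \prod_(t < lift ord0 i) Q t = Q 0%N * S.
  rewrite mulr_sumr; apply: eq_bigr => i _.
  rewrite /= big_ord_recl /= -scalerAr; congr (_ *: (_ * _)).
have size_Q : (1 < size (Q 0%N))%N by apply: Q_gt1.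
have [S0|S_neq0] := eqVneq S 0.
  rewrite S0 mulr0 addr0 alg_polyC polyC_eq0.
  case: k kK rk => // k kK rk; have : S != 0; last by rewrite S0 eqxx.
  apply: (IHK (fun k => r k.+1) (fun t => Q t.+1)); last by exists k.
  by move=> t tK; apply: Q_gt1.
have Q0 : Q 0%N != 0 by rewrite -size_poly_gt0; apply: ltnW.
rewrite -size_poly_gt0 addrC size_polyDl.
  by rewrite size_poly_gt0 mulf_neq0.
rewrite size_mul // (leq_ltn_trans (size_scale_leq _ _)) // size_poly1.
move: S_neq0 size_Q; rewrite -size_poly_gt0.
by case: (size S) (size (Q 0%N)) => [|a] [|b] //; rewrite addnS; lia.
Qed.

Lemma size_sum_partial_products (F : fieldType) (K D : nat) (r : nat -> F)
    (Q : nat -> {poly F}) :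
  (forall t, (t < K)%N -> (size (Q t) <= D.+1)%N) ->
  (size (\sum_(k < K) r k *: \prod_(t < k) Q t)%R <= (K * D).+1)%N.
Proof.
move=> Q_le; apply: leq_trans (size_sum _ _ _) _.
apply/bigmax_leqP => k _; apply: leq_trans (size_scale_leq _ _) _.
have : (size (\prod_(t < k) Q t)%R <= (k * D).+1)%N.
  rewrite -[X in (X * D)%N]card_ord -sum_nat_const.
  elim/big_ind2: _ => [|p a q b pa qb|i _].
  - by rewrite size_poly1.
  - by apply: leq_trans (size_polyMleq _ _) _; move: pa qb; lia.
  by apply: Q_le; apply: ltn_trans (ltn_ord k).
by move/leq_trans; apply; rewrite ltnS leq_mul // ltnW.
Qed.

(** * Iterates of triangular maps *)

Section TriangularMap.
Variables (F : finFieldType) (m : nat).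
Local Notation state := {ffun 'I_m.+1 -> F}.
Variables (Phi : state -> state) (gam eta : 'I_m.+1 -> state -> F).

(** The coefficients gam and eta are functions on the states: of polynomials
that define them, only the independence of the earlier coordinates is kept. *)
Definition triangular_map : Prop :=
  [/\ forall w i, Phi w i = w i * gam i w + eta i w,
      forall (i : 'I_m.+1) (w w' : state), (forall l : 'I_m.+1, (i < l)%N -> w l = w' l) ->
        gam i w = gam i w'
    & forall (i : 'I_m.+1) (w w' : state), (forall l : 'I_m.+1, (i < l)%N -> w l = w' l) ->
        eta i w = eta i w'].

Hypothesis Phi_tri : triangular_map.

(** The derivative of the s-th component of the k-th iterate of Phi with respect
to the s-th coordinate, see [iter_shift]. *)
Definition slope (s : 'I_m.+1) (k : nat) (w : state) : F :=
  \prod_(t < k) gam s (iter t Phi w).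

Lemma iter_shift_above (j : 'I_m.+1) x w k (i : 'I_m.+1) : (j < i)%N ->
  iter k Phi (shift j x w) i = iter k Phi w i.
Proof.
have [PhiE gamE etaE] := Phi_tri.
elim: k i => [|k IHk] i ji /=.
  by rewrite ffunE ifN ?addr0 // -val_eqE /= gtn_eqF.
rewrite !PhiE IHk //; congr (_ * _ + _).
  by apply: gamE => l il; apply: IHk; apply: ltn_trans il.
by apply: etaE => l il; apply: IHk; apply: ltn_trans il.
Qed.

Lemma iter_shift (j : 'I_m.+1) x w k :
  iter k Phi (shift j x w) j = iter k Phi w j + x * slope j k w.
Proof.
have [PhiE gamE etaE] := Phi_tri.
elim: k => [|k IHk] /=; first by rewrite ffunE eqxx /slope big_ord0 mulr1.
rewrite !PhiE IHk /slope big_ord_recr /= -/(slope j k w).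
rewrite (gamE _ (iter k Phi (shift j x w)) (iter k Phi w)); last first.
  by move=> l jl; apply: iter_shift_above.
rewrite (etaE _ (iter k Phi (shift j x w)) (iter k Phi w)); last first.
  by move=> l jl; apply: iter_shift_above.
by rewrite mulrDl mulrA addrAC.
Qed.

Variable E : {set state}.
Hypothesis gam_neq0 : forall i w, w \notin E -> gam i w != 0.

(** Off E each component can be solved for its own coordinate, starting from the
last component. *)
Lemma triangular_map_inj : {in [predC E] &, injective Phi}.
Proof.
have [PhiE gamE etaE] := Phi_tri.
move=> w w' wE _ PhiW.
suff ext n (i : 'I_m.+1) : (m - i < n)%N -> w i = w' i.
  by apply/ffunP => i; apply: (ext m.+1); lia.
elim: n i => // n IHn i i_n.
have above (l : 'I_m.+1) : (i < l)%N -> w l = w' l.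
  by move=> il; apply: IHn; have := ltn_ord l; lia.
have := congr1 (fun v : state => v i) PhiW; rewrite !PhiE.
rewrite -(gamE _ _ _ above) -(etaE _ _ _ above) => /addIr.
by apply: mulIf; apply: gam_neq0.
Qed.

Definition hits (K : nat) : {set state} :=
  [set w | [exists t : 'I_K, iter t Phi w \in E]].

Lemma notin_hits K w t : w \notin hits K -> (t < K)%N -> iter t Phi w \notin E.
Proof.
rewrite inE negb_exists => /forallP nE tK.
exact: (nE (Ordinal tK)).
Qed.

(** Until its first visit to E an orbit runs in the region where Phi is
injective, so at most #|E| states visit E for the first time at a given time. *)
Lemma card_hits K : (#|hits K| <= K * #|E|)%N.
Proof.
elim: K => [|K IHK].
  rewrite (_ : hits 0 = finset.set0) ?cards0 //; apply/finset.setP => w; rewrite !inE.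
  by apply/existsP => -[[]].
pose later := [set w in [predC E] | Phi w \in hits K].
(* a visit at a time t > 0 is a visit of the orbit of Phi w at time t - 1 *)
have sub : hits K.+1 \subset E :|: later.
  apply/fintype.subsetP => w; rewrite !inE => /existsP[t].
  case: (boolP (w \in E)) => //= wE.
  case: t => -[|t] /= tK; first by rewrite (negPf wE).
  by rewrite -[Phi _]/(iter t.+1 Phi w) iterSr => tE; apply/existsP; exists (Ordinal (tK : (t < K)%N)).
apply: leq_trans (subset_leq_card sub) _.
apply: leq_trans (leq_card_setU _ _).1 _.
rewrite mulSn leq_add2l; apply: leq_trans IHK.
rewrite -(@card_in_imset _ _ Phi later).
  by apply/subset_leq_card/fintype.subsetP => _ /imsetP[w /[!inE] /andP[_ ?] ->].
by move=> w w' /setIdP[wE _] /setIdP[wE' _]; apply: triangular_map_inj.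
Qed.

(** A nontrivial linear relation between the slopes in direction s has few
solutions: along a line in the next direction s + 1, the slopes are partial
products of nonconstant polynomials as long as the orbits avoid E. *)
Lemma card_slope_relation (s s' : 'I_m.+1) (D K : nat) (r : nat -> F)
    (line : state -> {poly F}) :
  s' = s.+1 :> nat ->
  (forall w, [/\ (size (line w) <= D.+1)%N,
     forall x, (line w).[x] = gam s (shift s' x w)
     & w \notin E -> (1 < size (line w))%N]) ->
  (exists2 k, (k < K)%N & r k != 0) ->
  (#|[set w : state | (\sum_(k < K) r k * slope s k w == 0)%R]|
    <= K * #|E| + K * D * #|F| ^ m)%N.
Proof.
have [PhiE gamE etaE] := Phi_tri.
move=> ss' lineP r_neq0; set A := [set w | _].
pose good := [set w in A | w \notin hits K].
have sub : A \subset hits K :|: good.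
  apply/fintype.subsetP => w wA; rewrite finset.in_setU [w \in good]inE wA /=.
  by case: (w \in hits K).
apply: leq_trans (subset_leq_card sub) _.
apply: leq_trans (leq_card_setU _ _).1 _.
apply: leq_add; first exact: card_hits.
apply: (@card_le_lines _ _ s') => w0 /setIdP[_ w0_good].
(* along this line, the coordinate s' of the t-th iterate is affine in the
   parameter and the later coordinates are constant *)
pose Q t := line (iter t Phi w0) \Po (slope s' t w0 *: 'X).
have slope_neq0 t : (t < K)%N -> slope s' t w0 != 0.
  move=> tK; apply/prodf_neq0 => u _; apply: gam_neq0.
  by apply: notin_hits w0_good _; apply: ltn_trans tK.
have sizeQ t : (t < K)%N -> size (Q t) = size (line (iter t Phi w0)).
  move=> tK; apply: size_comp_poly2.
  by rewrite size_scale ?size_polyX ?slope_neq0.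
pose L := \sum_(k < K) r k *: \prod_(t < k) Q t.
have L_neq0 : L != 0.
  apply: sum_partial_products_neq0 => // t tK; rewrite sizeQ //.
  by have [_ _] := lineP (iter t Phi w0); apply; apply: notin_hits w0_good _.
have sizeL : (size L <= (K * D).+1)%N.
  apply: size_sum_partial_products => t tK; rewrite sizeQ //.
  by have [] := lineP (iter t Phi w0).
have hornerL x : L.[x] = \sum_(k < K) r k * slope s k (shift s' x w0).
  rewrite /L horner_sum; apply: eq_bigr => k _.
  rewrite hornerZ horner_prod; congr (_ * _); apply: eq_bigr => t _.
  rewrite horner_comp hornerZ hornerX.
  have [_ -> _] := lineP (iter t Phi w0); apply: gamE => l sl.
  rewrite ffunE; case: eqVneq => [->|ls']; first by rewrite iter_shift mulrC.
  rewrite addr0 iter_shift_above //.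
  by move: ls'; rewrite -val_eqE /= ss' ltn_neqAle sl eq_sym => ->.
rewrite -ltnS; apply: leq_trans sizeL.
rewrite cardE; apply: max_poly_roots L_neq0 _ (enum_uniq _).
apply/allP => x; rewrite mem_enum inE => /setIdP[+ _].
by rewrite inE /root hornerL.
Qed.

End TriangularMap.

(** * Character sums along a triangular map *)

Lemma shift_bij (F : finFieldType) (n : nat) (j : 'I_n) (x : F) :
  injective (shift j x).
Proof.
move=> w w' e; apply/ffunP => i.
by have := congr1 (fun v : {ffun 'I_n -> F} => v i) e; rewrite !ffunE => /addIr.
Qed.

Section CharacterSums.
Variables (F : finFieldType) (C : numClosedFieldType) (e : F -> C).

Definition additive_character : Prop :=
  [/\ forall x y, e (x + y) = e x * e y, forall x, `|e x| = 1
    & forall a, a != 0 -> \sum_x e (a * x) = 0].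

Hypothesis eP : additive_character.

Let eD x y : e (x + y) = e x * e y. Proof. by have [] := eP. Qed.
Let e_norm x : `|e x| = 1. Proof. by have [] := eP. Qed.

Lemma character0 : e 0 = 1.
Proof.
have e0 : e 0 != 0 by rewrite -normr_gt0 e_norm ltr01.
by apply: (mulfI e0); rewrite -eD addr0 mulr1.
Qed.

Lemma characterN x : e (- x) = (e x)^*.
Proof.
have ex : e x != 0 by rewrite -normr_gt0 e_norm ltr01.
apply: (mulfI ex); rewrite -eD subrr character0.
by rewrite -normCK e_norm expr1n.
Qed.

Lemma character_sum (I : Type) (r : seq I) (P : pred I) (x : I -> F) :
  e (\sum_(i <- r | P i) x i) = \prod_(i <- r | P i) e (x i).
Proof. by apply: big_morph => //; apply: character0. Qed.

Variables (m : nat) (Phi : {ffun 'I_m.+1 -> F} -> {ffun 'I_m.+1 -> F}).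
Variables gam eta : 'I_m.+1 -> {ffun 'I_m.+1 -> F} -> F.
Hypothesis Phi_tri : triangular_map Phi gam eta.
Variables (a : 'I_m.+1 -> F) (s : 'I_m.+1).
Hypotheses (as_neq0 : a s != 0) (a_lt_s : forall i : 'I_m.+1, (i < s)%N -> a i = 0).

Definition linear_form (w : {ffun 'I_m.+1 -> F}) : F := \sum_i a i * w i.

Lemma linear_form_iter_shift x w k :
  linear_form (iter k Phi (shift s x w)) =
  linear_form (iter k Phi w) + a s * (slope Phi gam s k w * x).
Proof.
rewrite /linear_form !(bigD1 s (P := xpredT)) //= (iter_shift Phi_tri) mulrDr.
rewrite [x * _]mulrC addrAC; congr (_ + _ + _).
apply: eq_bigr => i i_s; have [is_lt|si_lt|/val_inj e_is] := ltngtP i s.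
- by rewrite a_lt_s // !mul0r.
- by rewrite (iter_shift_above Phi_tri).
by rewrite e_is eqxx in i_s.
Qed.

(** Along a line in direction s the argument of the character is affine, so
only the lines on which it is constant contribute. *)
Lemma norm_character_sum (K : nat) (r : nat -> F) :
  `|\sum_w e (\sum_(k < K) r k * linear_form (iter k Phi w))| <=
  #|[set w | \sum_(k < K) r k * slope Phi gam s k w == 0]|%:R.
Proof.
pose phi w := e (\sum_(k < K) r k * linear_form (iter k Phi w)).
pose Q w := \sum_(k < K) r k * slope Phi gam s k w.
have q_gt0 : 0 < #|F|%:R :> C by rewrite ltr0n; apply/card_gt0P; exists 0.
have phiE x w : phi (shift s x w) = phi w * e (a s * Q w * x).
  rewrite /phi -eD; congr (e _); rewrite -mulrA mulr_suml mulr_sumr -big_split /=.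
  apply: eq_bigr => k _; rewrite linear_form_iter_shift; ring.
rewrite -/(phi _) -(ler_pM2l q_gt0) -[X in X * `|_|]ger0_norm ?(ltW q_gt0) // -normrM.
(* each of the #|F| translations in direction s permutes the states *)
have -> : #|F|%:R * (\sum_w phi w) = \sum_w phi w * \sum_x e (a s * Q w * x).
  transitivity (\sum_(x : F) \sum_w phi (shift s x w)).
    rewrite mulr_natl -sumr_const; apply: eq_big => // x _.
    by rewrite (reindex_inj (shift_bij (j := s) (x := x))).
  rewrite exchange_big; apply: eq_bigr => w _ /=.
  by rewrite mulr_sumr; apply: eq_bigr => x _; rewrite phiE.
have -> : #|F|%:R * #|[set w | Q w == 0]|%:R =
    \sum_w (if Q w == 0 then #|F|%:R else 0) :> C.
  rewrite -sum1_card natr_sum mulr_sumr big_mkcond /=.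
  by apply: eq_bigr => w _; rewrite inE mulr1.
apply: le_trans (ler_norm_sum _ _ _) _; apply: ler_sum => w _.
rewrite normrM e_norm mul1r.
case: eqVneq => [->|Qw].
  apply: le_trans (ler_norm_sum _ _ _) _.
  rewrite (eq_bigr (fun=> 1)) => [|x _]; last by rewrite e_norm.
  by rewrite sumr_const.
by have [_ _ ->] := eP; rewrite ?normr0 // mulf_neq0.
Qed.

Section Moments.
Variables (K nu : nat) (bound : nat).
Hypothesis nu_char : forall n, (0 < n <= nu)%N -> n%:R != 0 :> F.
Hypothesis boundP : forall r : nat -> F,
  (exists2 k, (k < K)%N & r k != 0) ->
  (#|[set w | (\sum_(k < K) r k * slope Phi gam s k w == 0)%R]| <= bound)%N.

Local Notation multi := {ffun 'I_nu -> 'I_K}.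

Definition occ (kap : multi) (k : nat) : nat := \sum_(j < nu) (kap j == k :> nat).

Lemma sum_occ (kap : multi) (x : nat -> F) :
  \sum_(j < nu) x (kap j) = \sum_(k < K) (occ kap k)%:R * x k.
Proof.
transitivity (\sum_(k < K) \sum_(j < nu) (kap j == k :> nat)%:R * x k); last first.
  by apply: eq_bigr => k _; rewrite /occ natr_sum mulr_suml.
rewrite exchange_big; apply: eq_bigr => j _ /=.
rewrite (bigD1 (kap j)) //= eqxx mul1r big1 ?addr0 // => k k_neq.
by rewrite [_ == _]eq_sym [_ == _](negPf k_neq) mul0r.
Qed.

Definition balanced (kap kap' : multi) : bool :=
  [forall k : 'I_K, (occ kap k)%:R - (occ kap' k)%:R == 0 :> F].

(** Occurrence numbers are at most nu, so the characteristic does not make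
different ones equal; then kap' takes only values that kap takes. *)
Lemma card_balanced (kap : multi) :
  (#|[set kap' | balanced kap kap']| <= nu ^ nu)%N.
Proof.
rewrite -[X in (_ <= X ^ _)%N]card_ord -[X in (_ <= _ ^ X)%N]card_ord -card_ffun.
pose comp (tau : {ffun 'I_nu -> 'I_nu}) : multi := [ffun j => kap (tau j)].
rewrite -cardsT; apply: leq_trans (leq_imset_card comp _).
apply/subset_leq_card/fintype.subsetP => kap' /[!inE] /forallP bal.
pose tau := [ffun j => odflt j [pick i | kap i == kap' j]].
apply/imsetP; exists tau => //; apply/ffunP => j; rewrite !ffunE.
case: pickP => [i /eqP -> //|none].
have occ0 : occ kap (kap' j) = 0%N.
  rewrite /occ big1 // => i _; have := none i.
  by rewrite -val_eqE => ->.
have := bal (kap' j); rewrite occ0 sub0r oppr_eq0 => /eqP occ'0.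
suff /nu_char : (0 < occ kap' (kap' j) <= nu)%N by rewrite occ'0 eqxx.
rewrite /occ (bigD1 j) //= eqxx /= -[X in (_ <= X)%N]card_ord -sum1_card.
by rewrite [X in (_ <= X)%N](bigD1 j) //= !leq_add2l; apply: leq_sum => i _; apply: leq_b1.
Qed.

(** For an even exponent 2 nu, |Z|^(2 nu) is Z^nu times its conjugate, and the
conjugate of a character value is the value at the opposite argument. *)
Lemma norm_pow_character_sum w :
  `|\sum_(k < K) e (linear_form (iter k Phi w))| ^+ (2 * nu) =
  \sum_(kap : multi) \sum_(kap' : multi)
    e (\sum_(k < K) ((occ kap k)%:R - (occ kap' k)%:R) * linear_form (iter k Phi w)).
Proof.
set Z := \sum_(k < K) _.
have powZ : Z ^+ nu =
    \sum_(kap : multi) e (\sum_(j < nu) linear_form (iter (kap j) Phi w)).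
  rewrite -[X in _ ^+ X]card_ord -prodr_const /Z bigA_distr_bigA /=.
  by apply: eq_bigr => kap _; rewrite character_sum.
rewrite mulnC exprM -normrX normCK powZ rmorph_sum mulr_suml.
apply: eq_bigr => kap _; rewrite mulr_sumr; apply: eq_bigr => kap' _.
rewrite /= -characterN -eD; congr (e _).
rewrite !(sum_occ _ (fun k => linear_form (iter k Phi w))) -sumrB.
by apply: eq_bigr => k _; rewrite mulrBl.
Qed.

(** The 2 nu-th moment over all states: the balanced pairs of multi-indices are
bounded trivially, all others by the number of solutions of a slope relation. *)
Lemma moment_bound :
  \sum_w `|\sum_(k < K) e (linear_form (iter k Phi w))| ^+ (2 * nu) <=
  (nu ^ nu * K ^ nu * #|F| ^ m.+1 + K ^ (2 * nu) * bound)%:R :> C.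
Proof.
rewrite -[leLHS]ger0_norm; last by apply: sumr_ge0 => w _; rewrite exprn_ge0.
rewrite (eq_bigr _ (fun w _ => norm_pow_character_sum w)).
rewrite exchange_big /=.
under eq_bigr => kap _ do rewrite exchange_big /=.
have card_multi : #|multi| = (K ^ nu)%N by rewrite card_ffun !card_ord.
pose S (kap kap' : multi) := \sum_w e
  (\sum_(k < K) ((occ kap k)%:R - (occ kap' k)%:R) * linear_form (iter k Phi w)).
have S_le (kap kap' : multi) :
    `|S kap kap'| <= ((if balanced kap kap' then #|F| ^ m.+1 else 0) + bound)%N%:R.
  case: ifPn => [_|].
    apply: le_trans (ler_norm_sum _ _ _) _.
    rewrite (eq_bigr (fun=> 1)) => [|w _]; last by rewrite e_norm.
    by rewrite sumr_const card_ffun card_ord ler_nat leq_addr.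
  rewrite negb_forall => /existsP[k rk]; rewrite add0n.
  pose r k := (occ kap k)%:R - (occ kap' k)%:R : F.
  apply: le_trans (norm_character_sum K r) _.
  rewrite ler_nat; apply: (boundP (r := r)).
  by exists (val k); [apply: ltn_ord|apply: rk].
apply: le_trans (ler_norm_sum _ _ _) _.
apply: le_trans (ler_sum _ (fun kap _ => ler_norm_sum _ _ _)) _.
apply: le_trans (ler_sum _ (fun kap _ => ler_sum _ (fun kap' _ => S_le kap kap'))) _.
under eq_bigr => kap _ do rewrite -natr_sum.
rewrite -natr_sum ler_nat.
apply: (@leq_trans (\sum_(kap : multi) (nu ^ nu * #|F| ^ m.+1 + K ^ nu * bound))).
  apply: leq_sum => kap _; rewrite big_split /= sum_nat_const card_multi leq_add2r.
  by rewrite -big_mkcond sum_nat_const leq_mul2r -cardsE card_balanced orbT.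
rewrite sum_nat_const card_multi mulnDr mulnA [(K ^ nu * nu ^ nu)%N]mulnC.
by rewrite mulnA -expnD addnn mul2n.
Qed.
End Moments.
End CharacterSums.

(** * Triangular families of polynomials *)

Lemma meval_in_vars_above (F : fieldType) (n : nat) (i : 'I_n) (q : mpolys n F)
    (w w' : 'I_n -> F) :
  in_vars_above i q -> (forall l : 'I_n, (i < l)%N -> w l = w' l) ->
  meval w q = meval w' q.
Proof.
move=> q_above ww'; rewrite !mevalE big_seq [RHS]big_seq.
apply: eq_bigr => mu mu_q; congr (_ * _); apply: eq_bigr => j _.
by have [ji|/ww' -> //] := leqP j i; rewrite (q_above _ mu_q).
Qed.

(** The set E consists of the zeros of the g_i and of their partial derivatives
with respect to X_(i+1). These derivatives are nonzero polynomials because the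
leading monomial of g_i contains X_(i+1) with an exponent between 1 and d, which
is nonzero in F; where they do not vanish, g_i is not constant on the line in
direction i + 1. *)
Lemma triangular_family_map (F : finFieldType) (m d : nat)
    (f : 'I_m.+1 -> mpolys m.+1 F) :
  family_degree f d -> triangular_family f ->
  (forall n, (0 < n <= d)%N -> n%:R != 0 :> F) ->
  exists (gam eta : 'I_m.+1 -> {ffun 'I_m.+1 -> F} -> F)
    (line : 'I_m.+1 -> {ffun 'I_m.+1 -> F} -> {poly F})
    (E : {set {ffun 'I_m.+1 -> F}}),
  [/\ triangular_map (next_state f) gam eta,
      forall i w, w \notin E -> gam i w != 0,
      (#|E| <= 2 * m * m.+1 * d.+1 * #|F| ^ m)%N
    & forall s s' : 'I_m.+1, s' = s.+1 :> nat -> forall w,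
      [/\ (size (line s w) <= d.+1)%N,
          forall x, (line s w).[x] = gam s (shift s' x w)
        & w \notin E -> (1 < size (line s w))%N]].
Proof.
move=> fd [a [b [g [h [gtil [s [a_neq0 fmax s_neq0 fP]]]]]]] d_char.
(* deg (X_i g_i) exceeds deg h_i, so the terms of highest degree of X_i g_i
   survive in f_i *)
have msize_g (i : 'I_m.+1) : (i < m)%N -> (msize (g i) <= d)%N.
  move=> im; have [_ fi _ [_ mg] mh] := fP i im.
  have g_neq0 : g i != 0 by rewrite -(mmeasure_poly_eq0 mdeg) mg.
  have Xi : mvar i * g i = f i - h i by rewrite fi addrK.
  have X_neq0 : mvar i != 0 :> mpolys m.+1 F.
    by rewrite -(mmeasure_poly_eq0 mdeg) mmeasureX.
  have := msizeM X_neq0 g_neq0; rewrite Xi msizeX mdeg1 add2n /= => e.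
  have := mmeasureD_le mdeg (f i) (- h i); rewrite mmeasureN e.
  have : (msize (f i) <= d.+1)%N by rewrite -fd; apply: leq_bigmax.
  rewrite leq_max => fd'; case/orP => [/leq_trans/(_ fd')//|].
  by move/leq_trans/(_ mh); rewrite ltnn.
pose next (i : 'I_m.+1) : 'I_m.+1 := inord i.+1.
have nextE (i : 'I_m.+1) : (i < m)%N -> next i = i.+1 :> nat.
  by move=> im; rewrite inordK.
have deriv_neq0 (i : 'I_m.+1) : (i < m)%N -> mderiv (next i) (g i) != 0.
  move=> im; have [_ _ gi [mgtil mg] _] := fP i im.
  pose mu : multinom m.+1 :=
    Multinom [tuple (if (i < j)%N then s i j else 0%N) | j < m.+1].
  have muE j : mu j = if (i < j)%N then s i j else 0%N by rewrite mnmE.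
  have mdeg_mu : mdeg mu = (msize (g i)).-1.
    by rewrite mg mdegE /= [RHS]big_mkcond; apply: eq_bigr => j _; rewrite muE.
  have mu_g : mcoeff mu (g i) = 1.
    rewrite gi mcoeffD (_ : \prod_(j < _ | _) _ = mpolyX F mu).
      rewrite mcoeffX eqxx (memN_msupp_eq0 (p := gtil i)) ?addr0 //.
      by apply: msize_mdeg_ge; rewrite mdeg_mu; lia.
    rewrite mpolyXE_id big_mkcond; apply: eq_bigr => j _; rewrite muE.
    by case: ifP.
  have mu_next : mu (next i) = s i i.+1 by rewrite muE nextE // ltnSn.
  have mu_gt0 : (0 < mu (next i))%N.
    rewrite mu_next lt0n; apply: contraNneq s_neq0 => s0.
    by rewrite (bigD1 (Ordinal im)) //= s0.
  apply/eqP => /(congr1 (mcoeff (mnm_sub mu (mnm1 (next i))))).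
  rewrite mcoeff_deriv mcoeff0 submK; last first.
    by rewrite lep1mP -lt0n.
  rewrite mu_g mnmBE mnm1E eqxx subn1 prednK // => /eqP.
  apply/negP; apply: d_char; rewrite mu_gt0 /=.
  apply: leq_trans (msize_g i im).
  have : (mu (next i) <= mdeg mu)%N by rewrite mdegE (bigD1 (next i)) //= leq_addr.
  by rewrite mdeg_mu; lia.
(* the last component a X_m + b is affine with constant coefficients *)
pose gam (i : 'I_m.+1) (w : {ffun 'I_m.+1 -> F}) := if (i < m)%N then meval w (g i) else a.
pose eta (i : 'I_m.+1) (w : {ffun 'I_m.+1 -> F}) := if (i < m)%N then meval w (h i) else b.
pose bad (i : 'I_m) := zeros (g (widen_ord (leqnSn m) i))
  :|: zeros (mderiv (next (widen_ord (leqnSn m) i)) (g (widen_ord (leqnSn m) i))).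
exists gam, eta, (fun i w => line_poly (next i) w (g i)), (\bigcup_i bad i).
have in_bad (i : 'I_m.+1) w : (i < m)%N -> w \notin \bigcup_i bad i ->
    meval w (g i) != 0 /\ meval w (mderiv (next i) (g i)) != 0.
  move=> im; rewrite (_ : i = widen_ord (leqnSn m) (Ordinal im)); last exact: val_inj.
  set j := Ordinal im => wE; have : w \notin bad j.
    by apply: contra wE => wj; apply/finset.bigcupP; exists j.
  by rewrite !inE negb_or => /andP.
split.
- split=> [w i|i w w' ww'|i w w' ww']; rewrite /gam /eta ?ffunE; case: ltnP => im //.
  + by have [_ -> _ _ _] := fP i im; rewrite mevalD mevalM mevalXU.
  + have -> : i = ord_max by apply/val_inj/eqP; rewrite eqn_leq im -ltnS ltn_ord.
    by rewrite fmax mevalD mevalZ mevalXU mevalC mulrC.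
  + by have [[gi _ _] _ _ _ _] := fP i im; apply: meval_in_vars_above ww'.
  + by have [[_ hi _] _ _ _ _] := fP i im; apply: meval_in_vars_above ww'.
- by move=> i w wE; rewrite /gam; case: ltnP => im //; have [] := in_bad i w im wE.
- have card_z (q : mpolys m.+1 F) :
      q != 0 -> (msize q <= d)%N -> (#|zeros q| <= m.+1 * d.+1 * #|F| ^ m)%N.
    move=> q_neq0 qd; have F_gt0 : (0 < #|F|)%N by apply/card_gt0P; exists 0.
    rewrite -(leq_pmul2r F_gt0); apply: leq_trans (card_zeros q_neq0) _.
    by rewrite expnSr mulnA !leq_mul // (leq_trans qd).
  have card_bad (i : 'I_m) : (#|bad i| <= 2 * (m.+1 * d.+1 * #|F| ^ m))%N.
    have im : (widen_ord (leqnSn m) i < m)%N by exact: (ltn_ord i).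
    apply: leq_trans (leq_card_setU _ _).1 _; rewrite mul2n -addnn.
    apply: leq_add; apply: card_z; last 2 first.
    + exact: deriv_neq0.
    + by apply: leq_trans (msize_mderiv _ _) _; apply: msize_g.
    + have [_ _ _ [_ mg] _] := fP _ im.
      by rewrite -(mmeasure_poly_eq0 mdeg) mg.
    + exact: msize_g.
  have : (#|\bigcup_i bad i| <= \sum_(i < m) 2 * (m.+1 * d.+1 * #|F| ^ m))%N.
    apply: (@leq_trans (\sum_(i < m) #|bad i|)); last exact: leq_sum.
    elim/big_ind2: _ => [|A k B l Ak Bl|i _ //]; first by rewrite cards0.
    by apply: leq_trans (leq_card_setU _ _).1 _; apply: leq_add.
  by move/leq_trans; apply; rewrite sum_nat_const card_ord; lia.
move=> i i' ii' w; have im : (i < m)%N by have := ltn_ord i'; rewrite ii'.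
have -> : i' = next i by apply: val_inj; rewrite /= nextE.
split=> [|x|wE].
- by apply: leq_trans (size_line_poly _ _ _) _; apply: leq_trans (msize_g i im) _.
- by rewrite horner_line_poly /gam im.
rewrite ltnNge; apply/negP => /line_poly_constant/eqP; apply/negP.
by have [] := in_bad i w im wE.
Qed.

(** * Sums along an orbit *)

Section Orbits.
Variables (A : finType) (Phi : A -> A) (w0 : A).

(** Pure periodicity propagates a coincidence w_i = w_j to all times, earlier
ones included, so that j - i is a period. *)
Lemma periodic_orbit_inj T :
  purely_periodic (fun k => iter k Phi w0) T ->
  {in [pred n | n < T]%N &, injective (fun n => iter n Phi w0)}.
Proof.
move=> [T_gt0 per minT].
have perM n k : iter (n + k * T) Phi w0 = iter n Phi w0.
  by elim: k => [|k IHk]; rewrite ?addn0 // mulSn addnCA addnC per.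
have lt_neq i j : (i < j)%N -> (j < T)%N -> iter i Phi w0 <> iter j Phi w0.
  move=> ij jT eij; have : (T <= j - i)%N; last by lia.
  apply: minT => [|n]; first by rewrite subn_gt0.
  rewrite -(perM _ i) -(perM n i).
  have le_i : (i <= n + i * T)%N by nia.
  rewrite (_ : n + (j - i) + i * T = (n + i * T - i) + j)%N; last by lia.
  by rewrite iterD -eij -iterD subnK.
move=> i j; rewrite !inE => iT jT eij.
by have [ij|ji|//] := ltngtP i j; [case: (lt_neq i j)|case: (lt_neq j i)].
Qed.

Lemma sum_orbit_le (C : numDomainType) (T N : nat) (phi : A -> C) :
  purely_periodic (fun k => iter k Phi w0) T -> (N <= T)%N ->
  (forall w, 0 <= phi w) ->
  \sum_(n < N) phi (iter n Phi w0) <= \sum_w phi w.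
Proof.
move=> /periodic_orbit_inj inj NT phi_ge0.
pose h (n : 'I_N) := iter n Phi w0.
have h_inj : injective h.
  move=> i j e; apply/val_inj/inj => //; rewrite inE.
    exact: leq_trans (ltn_ord i) NT.
  exact: leq_trans (ltn_ord j) NT.
rewrite -(big_imset (h := h) _ (A := xpredT)) /=; last by move=> ? ? _ _; apply: h_inj.
rewrite [X in X <= _]big_mkcond /=; apply: ler_sum => w _.
by case: ifP.
Qed.

Lemma orbit_length_le (T : nat) :
  purely_periodic (fun k => iter k Phi w0) T -> (T <= #|A|)%N.
Proof.
move=> /periodic_orbit_inj inj; rewrite -[T]card_ord.
apply: (@leq_card _ _ (fun n : 'I_T => iter n Phi w0)) => i j e.
by apply: val_inj; apply: inj e; rewrite inE ltn_ord.
Qed.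

End Orbits.

(** Replacing z n by z (n + k) changes a sum over an initial segment by at most
2 k; average over k < K. *)
Lemma shifted_sum_bound (C : numDomainType) (N K : nat) (z : nat -> C) :
  (forall n, `|z n| <= 1) ->
  K%:R * `|\sum_(n < N) z n| <=
  \sum_(n < N) `|\sum_(k < K) z (n + k)%N| + (2 * K ^ 2)%:R.
Proof.
move=> z_le1; pose Z k := \sum_(n < N) z (n + k)%N.
have stepZ k : `|Z k - Z k.+1| <= 2%:R.
  rewrite distrC /Z -sumrB.
  under eq_bigr => n _ do rewrite addnS -addSn.
  rewrite -(big_mkord xpredT (fun n => z (n.+1 + k)%N - z (n + k)%N)).
  rewrite (telescope_sumr (fun n => z (n + k)%N)) //.
  by apply: le_trans (ler_normB _ _) _; rewrite (natrD _ 1 1) lerD.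
have Zk k : `|Z 0%N - Z k| <= (2 * k)%:R.
  elim: k => [|k IHk]; first by rewrite subrr normr0.
  rewrite -(subrK (Z k) (Z 0%N)) -addrA; apply: le_trans (ler_normD _ _) _.
  by rewrite mulnS addnC natrD lerD.
have -> : \sum_(n < N) z n = Z 0%N by apply: eq_bigr => n _; rewrite addn0.
have -> : K%:R * `|Z 0%N| = `|\sum_(k < K) Z k + \sum_(k < K) (Z 0%N - Z k)|.
  rewrite -big_split /= (eq_bigr (fun=> Z 0%N)) => [|k _]; last by rewrite addrC subrK.
  by rewrite sumr_const card_ord normrMn mulr_natl.
apply: le_trans (ler_normD _ _) _; apply: lerD.
  by rewrite /Z exchange_big /=; apply: ler_norm_sum.
apply: le_trans (ler_norm_sum _ _ _) _.
apply: (@le_trans _ _ (\sum_(k < K) (2 * K)%:R)).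
  apply: ler_sum => k _; apply: le_trans (Zk k) _.
  by rewrite ler_nat leq_mul2l /= ltnW.
by rewrite sumr_const card_ord -mulrnA ler_nat -mulnn mulnA.
Qed.

(** Convexity of the power function: its graph lies above the tangent at A. *)
Lemma exprn_tangent (R : realDomainType) (x A : R) (M : nat) :
  0 <= x -> 0 <= A ->
  M.+1%:R * x * A ^+ M - M%:R * A ^+ M.+1 <= x ^+ M.+1.
Proof.
move=> x0 A0; elim: M => [|M IHM].
  by rewrite mul0r subr0 expr0 mulr1 mul1r expr1.
rewrite [leRHS]exprS; apply: le_trans (ler_wpM2l x0 IHM).
rewrite -subr_ge0.
have -> : x * (M.+1%:R * x * A ^+ M - M%:R * A ^+ M.+1) -
   (M.+2%:R * x * A ^+ M.+1 - M.+1%:R * A ^+ M.+2) =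
   M.+1%:R * A ^+ M * (x - A) ^+ 2.
  by rewrite !exprS expr0 -!natr1; ring.
by rewrite mulr_ge0 ?sqr_ge0 // mulr_ge0 ?exprn_ge0 ?ler0n.
Qed.

(** The sum of the tangent inequalities at the mean. *)
Lemma power_mean (R : realFieldType) (N M : nat) (x : 'I_N -> R) :
  (forall n, 0 <= x n) ->
  (\sum_n x n) ^+ M.+1 <= N%:R ^+ M * \sum_n x n ^+ M.+1.
Proof.
move=> x_ge0; have [N0|N_gt0] := posnP N.
  subst N; rewrite !big_ord0 mulr0 expr0n; by [].
have N_neq0 : N%:R != 0 :> R by rewrite pnatr_eq0 -lt0n.
pose A := (\sum_n x n) / N%:R.
have A0 : 0 <= A by rewrite divr_ge0 ?ler0n // sumr_ge0.
have sumE : \sum_n x n = N%:R * A by rewrite /A mulrC divfK.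
have : \sum_(n < N) (M.+1%:R * x n * A ^+ M - M%:R * A ^+ M.+1) <=
    \sum_n x n ^+ M.+1.
  by apply: ler_sum => n _; apply: exprn_tangent.
have -> : \sum_(n < N) (M.+1%:R * x n * A ^+ M - M%:R * A ^+ M.+1) =
    N%:R * A ^+ M.+1.
  rewrite sumrB -mulr_suml -mulr_sumr sumE sumr_const card_ord.
  by rewrite -mulr_natl !exprS -natr1; ring.
move=> le_sum; rewrite sumE exprMn exprSr -mulrA.
by rewrite ler_wpM2l // exprn_ge0.
Qed.

(** The line direction is the first index s with a_s nonzero; as the last
coefficient vanishes, s has a successor, in whose direction slope relations are
counted. *)
Lemma orbit_moment_bound (F : finFieldType) (C : numClosedFieldType) (e : F -> C)
    (m d nu K : nat) (f : 'I_m.+1 -> mpolys m.+1 F) (a : 'I_m.+1 -> F) :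
  additive_character e ->
  family_degree f d -> triangular_family f ->
  (forall n, (0 < n <= maxn d nu)%N -> n%:R != 0 :> F) ->
  a ord_max = 0 -> (exists i, a i != 0) ->
  \sum_w `|\sum_(k < K) e (linear_form a (iter k (next_state f) w))| ^+ (2 * nu) <=
  (nu ^ nu * K ^ nu * #|F| ^ m.+1
   + K ^ (2 * nu) * (K * (2 * m * m.+1 * d.+1 + d) * #|F| ^ m))%:R :> C.
Proof.
move=> eP fd ft char_large amax [i0 ai0].
have [|gam [eta [line [E [tri gam_neq0 cardE lineP]]]]] :=
    triangular_family_map fd ft.
  by move=> n /andP[n0 nd]; apply: char_large; rewrite n0 leq_max nd.
case: (@arg_minnP _ i0 (fun i => a i != 0) val ai0) => s as_neq0 s_min.
have sm : (s < m)%N.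
  rewrite ltn_neqAle -ltnS ltn_ord andbT; apply: contraNneq as_neq0 => sm.
  by rewrite (_ : s = ord_max) ?amax //; apply: val_inj.
have a_lt_s (i : 'I_m.+1) : (i < s)%N -> a i = 0.
  by move=> i_s; apply/eqP; apply: contraTT i_s => /s_min; rewrite -leqNgt.
apply: (moment_bound eP tri as_neq0 a_lt_s) => [n /andP[n0 nn]|r r_neq0].
  by apply: char_large; rewrite n0 leq_max nn orbT.
have s1 : (inord s.+1 : 'I_m.+1) = s.+1 :> nat by rewrite inordK.
apply: leq_trans (card_slope_relation tri gam_neq0 s1 (lineP _ _ s1) r_neq0) _.
have := leq_mul (leqnn K) cardE; nia.
Qed.

(** * The standard character of the prime field *)

Section ComplexModulus.
Local Open Scope complex_scope.
Variable R : realType.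
Implicit Types z w : R[i].

Lemma norm_normc z : `|z| = (normc z)%:C. Proof. by []. Qed.

Lemma normc_ge0 z : 0 <= normc z.
Proof. by rewrite -lecR -norm_normc normr_ge0. Qed.

Lemma normc_sum (I : Type) (r : seq I) (P : pred I) (z : I -> R[i]) :
  normc (\sum_(i <- r | P i) z i) <= \sum_(i <- r | P i) normc (z i).
Proof.
rewrite -lecR rmorph_sum -norm_normc /=.
exact: ler_norm_sum.
Qed.

Lemma normc_nat n : normc (n%:R : R[i]) = n%:R.
Proof.
apply: (@complexI R); rewrite -norm_normc rmorph_nat.
by rewrite ger0_norm ?ler0n.
Qed.

Lemma normc_prod (I : Type) (r : seq I) (P : pred I) (z : I -> R[i]) :
  normc (\prod_(i <- r | P i) z i) = \prod_(i <- r | P i) normc (z i).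
Proof. by apply: (big_morph _ (@normcM R)); rewrite -[1]/(1%:R) normc_nat. Qed.

Lemma normcB z w : normc (z - w) = normc (w - z).
Proof. by apply: (@complexI R); rewrite -!norm_normc distrC. Qed.

Lemma geometric_telescope (w : R[i]) (lo hi : nat) : (lo <= hi)%N ->
  (1 - w) * (\sum_(lo <= k < hi) w ^+ k) = w ^+ lo - w ^+ hi.
Proof.
move=> lohi; rewrite -opprB -[RHS]opprB -telescope_sumr // mulNr mulr_sumr.
by congr (- _); apply: eq_bigr => k _; rewrite mulrBl mul1r exprS.
Qed.

Lemma normc_exp_unit w n : normc w = 1 -> normc (w ^+ n) = 1.
Proof.
by move=> w1; apply: (@complexI R); rewrite -norm_normc normrX norm_normc w1 expr1n.
Qed.

(** The quotient of 1 - w^n by 1 - w is a sum of n numbers of modulus 1. *)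
Lemma normc_sub1_exp w n : normc w = 1 -> normc (1 - w ^+ n) <= n%:R * normc (1 - w).
Proof.
move=> w1; have := @geometric_telescope w 0 n (leq0n n).
rewrite expr0 => <-; rewrite normcM mulrC ler_wpM2r ?normc_ge0 //.
apply: le_trans (normc_sum _ _ _) _.
rewrite (eq_bigr (fun=> 1)) => [|k _]; last exact: normc_exp_unit.
by rewrite sumr_const_nat subn0.
Qed.

(** The product telescopes to a difference of two numbers of modulus 1. *)
Lemma normc_geometric_sum w (lo hi : nat) : normc w = 1 -> (lo <= hi)%N ->
  normc (1 - w) * normc (\sum_(lo <= k < hi) w ^+ k) <= 2.
Proof.
move=> w1 lohi; rewrite -normcM geometric_telescope //.
apply: le_trans (le_normcD _ _) _.
by rewrite normcN !normc_exp_unit //; lra.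
Qed.

End ComplexModulus.

Section RootOfUnity.
Local Open Scope complex_scope.
Variables (R : realType) (p : nat).
Hypothesis p_prime : prime p.

Let p_gt0 : (0 < p)%N. Proof. exact: prime_gt0. Qed.
Let pR_gt0 : 0 < p%:R :> R. Proof. by rewrite ltr0n. Qed.

Definition angle : R := pi *+ 2 / p%:R.
Definition zeta : R[i] := cos angle +i* sin angle.

Lemma zetaX n : zeta ^+ n = cos (angle *+ n) +i* sin (angle *+ n).
Proof.
elim: n => [|n IHn]; first by rewrite expr0 !mulr0n cos0 sin0.
rewrite exprS IHn /zeta !mulrS cosD sinD; congr (_ +i* _).
by rewrite addrC [sin _ * _]mulrC [cos _ * _]mulrC addrC; congr (_ + _); rewrite mulrC.
Qed.

Lemma normc_zetaX n : normc (zeta ^+ n) = 1.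
Proof. by rewrite zetaX /= cos2Dsin2 sqrtr1. Qed.

Lemma zetaXp : zeta ^+ p = 1.
Proof.
have -> : zeta ^+ p = cos (pi *+ 2) +i* sin (pi *+ 2).
  by rewrite zetaX -[angle *+ p]mulr_natr divfK ?gt_eqF.
by rewrite cos2pi sin2pi.
Qed.

(** Some power n <= 3 p / (4 a) turns zeta ^ a into the left half plane, where
the distance to 1 is at least 1. *)
Lemma zeta_far_half a : (0 < a)%N -> (2 * a <= p)%N ->
  4 * a%:R <= 3 * p%:R * normc (1 - zeta ^+ a).
Proof.
(* n is p / (4 a) rounded up: the argument of the n-th power is between
   pi / 2 and 3 pi / 2 *)
move=> a_gt0 ap; pose n := ((p + 4 * a - 1) %/ (4 * a))%N.
have a4_gt0 : (0 < 4 * a)%N by lia.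
have n_lo : (p <= 4 * (a * n))%N.
  have := divn_eq (p + 4 * a - 1) (4 * a); rewrite -/n.
  by have := ltn_pmod (p + 4 * a - 1) a4_gt0; nia.
have n_hi : (4 * (a * n) <= 3 * p)%N.
  have := divn_eq (p + 4 * a - 1) (4 * a); rewrite -/n.
  by have : (0 < p)%N := p_gt0; nia.
have cos_le0 : cos (angle *+ (a * n)) <= 0.
  have -> : angle *+ (a * n) = (angle *+ (a * n) - pi) + pi by rewrite subrK.
  rewrite cosDpi oppr_le0; apply: cos_ge0_pihalf.
  have -> : angle *+ (a * n) - pi = pi * ((2 * (a * n)%:R) / p%:R - 1).
    by rewrite /angle -[pi *+ 2]mulr_natr -mulr_natr; ring.
  have -> : - (pi / 2) = pi * (- 2^-1) :> R by ring.
  rewrite !ler_pM2l ?pi_gt0 // lerBrDr lerBlDr ler_pdivlMr // ler_pdivrMr //.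
  apply/andP; split.
    have : (p%:R : R) <= (4 * (a * n))%:R by rewrite ler_nat.
    by rewrite natrM; lra.
  have : (4 * (a * n))%:R <= (3 * p)%:R :> R by rewrite ler_nat.
  by rewrite !natrM; lra.
have far : 1 <= normc (1 - zeta ^+ (a * n)).
  rewrite -lecR -norm_normc; apply: le_trans (normc_ge_Re _).
  rewrite lecR zetaX /= ger0_norm; lra.
have := @normc_sub1_exp _ _ n (normc_zetaX a); rewrite -exprM => le_n.
have le1 : 1 <= n%:R * normc (1 - zeta ^+ a) := le_trans far le_n.
have n_hi' : (4 * a%:R) * n%:R <= 3 * p%:R :> R by rewrite -!natrM ler_nat; lia.
have a_ge0 : 0 <= 4 * a%:R :> R by rewrite mulr_ge0 ?ler0n.
have := ler_wpM2l a_ge0 le1; rewrite mulr1 mulrA => /le_trans; apply.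
by apply: ler_wpM2r => //; apply: normc_ge0.
Qed.

(** For a > p / 2 the bound for p - a applies, because zeta ^ a and zeta ^ (p - a)
are conjugate; the sum of the two inverses dominates both cases. *)
Lemma zeta_far a : (0 < a < p)%N ->
  (normc (1 - zeta ^+ a))^-1 <= 3 * p%:R / 4 * (a%:R^-1 + (p - a)%:R^-1)
  /\ 0 < normc (1 - zeta ^+ a).
Proof.
have half b : (0 < b)%N -> (2 * b <= p)%N ->
    (normc (1 - zeta ^+ b))^-1 <= 3 * p%:R / 4 * b%:R^-1
    /\ 0 < normc (1 - zeta ^+ b).
  move=> b_gt0 bp; have far := zeta_far_half b_gt0 bp.
  have b_gt0' : 0 < b%:R :> R by rewrite ltr0n.
  have pos : 0 < normc (1 - zeta ^+ b).
    have p3 : 0 < 3 * p%:R :> R by rewrite mulr_gt0.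
    by rewrite -(pmulr_rgt0 _ p3); apply: lt_le_trans far; rewrite mulr_gt0.
  split => //; rewrite -[leLHS]mul1r ler_pdivrMr // mulrAC ler_pdivlMr //.
  lra.
have cst_ge0 : 0 <= 3 * p%:R / 4 :> R by rewrite divr_ge0 ?mulr_ge0 ?ler0n.
move=> /andP[a_gt0 ap]; have [a_small|a_big] := leqP (2 * a) p.
  have [le_a pos] := half a a_gt0 a_small; split => //.
  apply: le_trans le_a _; apply: ler_wpM2l => //.
  by rewrite lerDl invr_ge0 ler0n.
have pa : normc (1 - zeta ^+ a) = normc (1 - zeta ^+ (p - a)).
  rewrite -[LHS]mul1r -(normc_zetaX (p - a)) -normcM mulrBr mulr1 -exprD.
  by rewrite subnK ?(ltnW ap) // zetaXp normcB.
rewrite pa; have [||le_a pos] := half (p - a)%N; [lia|lia|split => //].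
apply: le_trans le_a _; apply: ler_wpM2l => //.
by rewrite lerDr invr_ge0 ler0n.
Qed.

Definition e_p (x : 'F_p) : R[i] := zeta ^+ x.

Lemma zetaX_mod k : zeta ^+ (k %% (Zp_trunc (pdiv p)).+2) = zeta ^+ k.
Proof. by rewrite Fp_cast // expr_mod // zetaXp. Qed.

Lemma e_p_exp (a : 'F_p) n : e_p (a *+ n) = e_p a ^+ n.
Proof.
have zeta_mod k : zeta ^+ (k %% (Zp_trunc (pdiv p)).+2) = zeta ^+ k.
  by rewrite Fp_cast // expr_mod // zetaXp.
elim: n => [|n IHn]; first by rewrite mulr0n expr0.
by rewrite mulrS exprS -IHn /e_p /= zetaX_mod exprD.
Qed.

Lemma e_p_eq1 (a : 'F_p) : a != 0 -> 0 < normc (1 - e_p a).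
Proof.
move=> a0; have [] // := @zeta_far a.
have := ltn_ord a; rewrite [X in (_ < X)%N -> _]Fp_cast // => ->.
by rewrite andbT lt0n; apply: contra a0 => /eqP e; apply/eqP/val_inj.
Qed.

Lemma e_p_character : additive_character e_p.
Proof.
have eD (x y : 'F_p) : e_p (x + y) = e_p x * e_p y.
  by rewrite /e_p /= zetaX_mod exprD.
split=> // [x|a a0]; first by rewrite norm_normc normc_zetaX.
have ea : 1 - e_p a != 0.
  by have := e_p_eq1 a0; apply: contraTneq => ->; rewrite normc0 ltxx.
(* translating x by 1 multiplies the sum by e_p a, which differs from 1 *)
apply: (mulfI ea); rewrite mulr0 mulrBl mul1r mulr_sumr.
rewrite (reindex_inj (addIr (1 : 'F_p))) /= -sumrB big1 // => x _.
by rewrite mulrDr mulr1 eD mulrC subrr.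
Qed.

End RootOfUnity.

(** * Fourier coefficients of intervals *)

(** Each 1 / (n + 1) is at most - ln (1 - 1 / (n + 1)), and these terms telescope. *)
Lemma harmonic_le_ln (R : realType) (n : nat) :
  (0 < n)%N -> \sum_(1 <= k < n.+1) (k%:R^-1 : R) <= 1 + ln n%:R.
Proof.
case: n => // n _; elim: n => [|n IHn].
  by rewrite big_nat1 invr1 ln1 addr0.
rewrite big_nat_recr //=; apply: le_trans (lerD IHn (lexx _)) _.
rewrite -addrA lerD2l.
have n1 : 0 < n.+1%:R :> R by rewrite ltr0n.
have n2 : 0 < n.+2%:R :> R by rewrite ltr0n.
have : ln (1 + - n.+2%:R^-1) <= - n.+2%:R^-1 :> R.
  by apply: le_ln1Dx; rewrite ltrN2 invf_lt1 // ltr1n.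
have -> : 1 + - n.+2%:R^-1 = n.+1%:R / n.+2%:R :> R.
  apply: (mulIf (lt0r_neq0 n2)); rewrite mulrDl mul1r mulNr.
  by rewrite mulVf ?divfK ?gt_eqF // -[n.+2%:R]natr1 addrK.
by rewrite ln_div ?posrE // lerBlDr -lerBrDr [- _ + _]addrC.
Qed.

Section IntervalFourier.
Local Open Scope complex_scope.
Variables (R : realType) (p : nat).
Hypothesis p_prime : prime p.
Variables lo hi : nat.
Hypotheses (lohi : (lo <= hi)%N) (hip : (hi <= p)%N).

Local Notation e := (e_p R (p := p)).

Let pR_gt0 : 0 < p%:R :> R. Proof. by rewrite ltr0n prime_gt0. Qed.
Let pC_neq0 : p%:R != 0 :> R[i].
Proof. by rewrite pnatr_eq0 -lt0n prime_gt0. Qed.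

Lemma sum_Fp_nat (V : nmodType) (P : pred nat) (g : nat -> V) :
  \sum_(y : 'F_p | P y) g y = \sum_(0 <= k < p | P k) g k.
Proof. by rewrite -(big_mkord P g) Fp_cast. Qed.

Lemma sum_Fp_interval (V : nmodType) (g : nat -> V) :
  \sum_(y : 'F_p | (lo <= y < hi)%N) g y = \sum_(lo <= k < hi) g k.
Proof.
rewrite (sum_Fp_nat (fun k => lo <= k < hi)%N) [RHS](big_nat_widenl lo 0) //.
by rewrite [RHS](big_nat_widen 0 hi p).
Qed.

(** The Fourier coefficients of the indicator of the interval from lo to hi, see
[interval_coef_inversion]. *)
Definition interval_coef (a : 'F_p) : R[i] :=
  p%:R^-1 * \sum_(y : 'F_p | (lo <= y < hi)%N) e (- (a * y)).

Lemma interval_coef_inversion (x : 'F_p) :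
  \sum_a interval_coef a * e (a * x) = (lo <= x < hi)%N%:R.
Proof.
have [eD e_norm e_sum] := e_p_character R p_prime.
transitivity (p%:R^-1 * \sum_(y : 'F_p | (lo <= y < hi)%N)
    \sum_a e (a * (x - y))).
  rewrite exchange_big mulr_sumr; apply: eq_bigr => a _ /=.
  rewrite /interval_coef -mulrA mulr_suml; congr (_ * _).
  by apply: eq_bigr => y _; rewrite -eD mulrBr addrC.
have inner y : \sum_a e (a * (x - y)) = if y == x then p%:R else 0.
  case: eqVneq => [->|yx].
    rewrite (eq_bigr (fun=> 1)) => [|a _]; last first.
      by rewrite subrr mulr0 (character0 (e_p_character R p_prime)).
    by rewrite sumr_const card_Fp.
  rewrite -[RHS](e_sum (x - y)) ?subr_eq0 1?eq_sym //.
  by apply: eq_bigr => a _; rewrite mulrC.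
under eq_bigr => y _ do rewrite inner.
rewrite -big_mkcondr /=; case: (boolP (lo <= x < hi)%N) => [x_in|x_out].
  rewrite (big_pred1 x) ?mulVf // => y /=.
  by rewrite andbC; case: eqVneq => //= ->.
rewrite big_pred0 ?mulr0 // => y; rewrite andbC.
by case: eqVneq => //= ->; apply: negPf.
Qed.

Lemma interval_coef0 : interval_coef 0 = ((hi - lo)%:R / p%:R)%:C.
Proof.
rewrite /interval_coef (eq_bigr (fun=> 1)) => [|y _]; last first.
  by rewrite mul0r oppr0 (character0 (e_p_character R p_prime)).
rewrite (sum_Fp_interval (fun=> 1)) sumr_const_nat.
by rewrite mulrC rmorphM fmorphV !rmorph_nat.
Qed.

Lemma normc_interval_coef_le1 a : normc (interval_coef a) <= 1.
Proof.
have [_ e_norm _] := e_p_character R p_prime.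
rewrite /interval_coef normcM normcV normc_nat mulrC ler_pdivrMr // mul1r.
apply: le_trans (normc_sum _ _ _) _.
rewrite (eq_bigr (fun=> 1)) => [|y _]; last first.
  by apply: (@complexI R); rewrite -norm_normc e_norm.
rewrite (sum_Fp_interval (fun=> 1)) sumr_const_nat ler_nat.
by apply: leq_trans hip; apply: leq_subr.
Qed.

(** The sum over the interval is geometric with ratio e (- a). *)
Lemma normc_interval_coef (a : 'F_p) : a != 0 ->
  normc (interval_coef a) <= 3 / 2 * (a%:R^-1 + (p - a)%:R^-1).
Proof.
move=> a0; have [eD e_norm _] := e_p_character R p_prime.
have e1 x : normc (e x) = 1.
  by apply: (@complexI R); rewrite -norm_normc e_norm.
have eNa : normc (1 - e (- a)) = normc (1 - e a).
  rewrite -[LHS]mul1r -(e1 a) -normcM mulrBr mulr1 -eD subrr.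
  by rewrite (character0 (e_p_character R p_prime)) normcB.
have a_p : (0 < a < p)%N.
  have := ltn_ord a; rewrite [X in (_ < X)%N -> _]Fp_cast // => ->.
  by rewrite andbT lt0n; apply: contra a0 => /eqP e'; apply/eqP/val_inj.
have [inv_le pos] := zeta_far R p_prime a_p.
rewrite -/(e a) in inv_le pos.
rewrite /interval_coef normcM normcV normc_nat.
have -> : \sum_(y : 'F_p | (lo <= y < hi)%N) e (- (a * y)) =
    \sum_(lo <= k < hi) e (- a) ^+ k.
  rewrite -sum_Fp_interval; apply: eq_bigr => y _.
  by rewrite -(e_p_exp R p_prime) -mulr_natr natr_Zp mulNr.
have := normc_geometric_sum (e1 (- a)) lohi; rewrite eNa.
set G := normc (\sum_(_ <= _ < _) _); set D := normc (1 - e a) in pos inv_le *.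
set r := _ + _ in inv_le * => DG.
have G_le : G <= 2 * D^-1 by rewrite ler_pdivlMr // mulrC.
apply: (@le_trans _ _ (p%:R^-1 * (2 * (3 * p%:R / 4 * r)))).
  rewrite ler_wpM2l ?invr_ge0 ?ler0n //; apply: le_trans G_le _.
  by rewrite ler_wpM2l.
suff -> : p%:R^-1 * (2 * (3 * p%:R / 4 * r)) = 3 / 2 * r by [].
by field; rewrite gt_eqF.
Qed.

(** Apart from the coefficient of index 0, the coefficients are dominated by a
harmonic sum and its reflection. *)
Lemma sum_interval_coef : \sum_a normc (interval_coef a) <= 4 + 3 * ln p%:R.
Proof.
rewrite (bigD1 0) //=.
apply: (@le_trans _ _ (1 + \sum_(a : 'F_p | (a : nat) != 0%N)
    3 / 2 * (a%:R^-1 + (p - a)%:R^-1))).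
  apply: lerD; first exact: normc_interval_coef_le1.
  rewrite [leRHS](eq_bigl (fun a : 'F_p => a != 0)) //.
  by apply: ler_sum => a; apply: normc_interval_coef.
rewrite (sum_Fp_nat (fun k => k != 0%N)
  (fun k => 3 / 2 * (k%:R^-1 + (p - k)%:R^-1))).
have -> : \sum_(0 <= k < p | k != 0%N) 3 / 2 * (k%:R^-1 + (p - k)%:R^-1) =
    3 * \sum_(1 <= k < p) (k%:R^-1 : R).
  rewrite -mulr_sumr (eq_bigl (fun k => xpredT k && (1 <= k)%N)); last first.
    by move=> k; rewrite lt0n.
  rewrite -(big_nat_widenl 1 0 p xpredT) // big_split /=.
  have -> : \sum_(1 <= k < p) ((p - k)%:R^-1 : R) = \sum_(1 <= k < p) k%:R^-1.
    rewrite [RHS]big_nat_rev /=; apply: eq_big_nat => k _.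
    by rewrite add1n subSS.
  by field.
have [n n_gt0 pn] : exists2 n, (0 < n)%N & p = n.+1.
  by exists p.-1; have := prime_gt1 p_prime; lia.
have ln_le : \sum_(1 <= k < p) (k%:R^-1 : R) <= 1 + ln p%:R.
  rewrite pn; apply: le_trans (harmonic_le_ln R n_gt0) _.
  by rewrite lerD2l ler_ln ?posrE ?ltr0n // ler_nat.
by move: ln_le; lra.
Qed.
End IntervalFourier.

(** * Discrepancy of points with denominator p *)

Lemma prod_diff_le (R : realDomainType) (m : nat) (x y : 'I_m -> R) (eps : R) :
  (forall i, 0 <= x i <= 1) -> (forall i, 0 <= y i <= 1) ->
  (forall i, `|x i - y i| <= eps) ->
  `|\prod_i x i - \prod_i y i| <= m%:R * eps.
Proof.
elim: m x y => [|m IHm] x y x01 y01 xy.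
  by rewrite !big_ord0 subrr normr0 mul0r.
rewrite !big_ord_recl /=; set X := \prod_i x _; set Y := \prod_i y _.
have XY : `|X - Y| <= m%:R * eps by apply: IHm.
have X01 : 0 <= X <= 1.
  apply/andP; split; first by apply: prodr_ge0 => i _; case/andP: (x01 (lift ord0 i)).
  by apply: prodr_ile1 => i *; apply: (x01 (lift ord0 i)).
have -> : x ord0 * X - y ord0 * Y = (x ord0 - y ord0) * X + y ord0 * (X - Y) by ring.
apply: le_trans (ler_normD _ _) _; rewrite !normrM -natr1 mulrDl mul1r addrC.
apply: lerD.
  case/andP: (y01 ord0) => y0 y1; rewrite [`|y _|]ger0_norm //.
  by apply: le_trans XY; rewrite ler_piMl.
case/andP: X01 => X0 X1; rewrite [`|X|]ger0_norm //.
by apply: le_trans (xy ord0); rewrite ler_piMr.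
Qed.

Lemma nat_threshold (R : realType) (x : R) : 0 <= x ->
  exists2 l : nat, x <= l%:R < x + 1 & forall k : nat, (x <= k%:R) = (l <= k)%N.
Proof.
move=> x0; have /andP[c_lo c_hi] := ceil_itv x.
have c_ge0 : 0 <= Num.ceil x by rewrite ceil_ge0; apply: lt_le_trans x0; rewrite oppr_lt0.
exists `|Num.ceil x|%N => [|k].
  rewrite natr_absz ger0_norm // c_hi /= -ltrBlDr.
  by apply: le_lt_trans c_lo; rewrite intrD lerD2l.
by rewrite -[k%:R]/((k%:Z)%:~R) -ceil_le_int -lez_nat gez0_abs.
Qed.

Section BoxDiscrepancy.
Local Open Scope complex_scope.
Variables (R : realType) (p : nat).
Hypothesis p_prime : prime p.
Variables (m N : nat) (u : 'I_N -> {ffun 'I_m.+1 -> 'F_p}) (M : R).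
Hypothesis N_gt0 : (0 < N)%N.
Hypothesis M_ge0 : 0 <= M.
Hypothesis sum_le : forall a : 'I_m.+1 -> 'F_p,
  a ord_max = 0 -> (exists i, a i != 0) ->
  normc (\sum_n e_p R (linear_form a (u n))) <= M.

Local Notation e := (e_p R (p := p)).
Let pR_gt0 : 0 < p%:R :> R. Proof. by rewrite ltr0n prime_gt0. Qed.

(** The character of index 0 gives the expected number of points; the others are
bounded by M, and the sum of the products of Fourier coefficients factors over
the coordinates. *)
Lemma box_count_error (lo hi : 'I_m -> nat) :
  (forall i, lo i <= hi i <= p)%N ->
  `|#|[pred n | [forall i : 'I_m,
       (lo i <= u n (widen_ord (leqnSn m) i) < hi i)%N]]|%:R / N%:R -
    \prod_i ((hi i - lo i)%:R / p%:R)| <= (4 + 3 * ln p%:R) ^+ m * M / N%:R.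
Proof.
move=> lohip; set A := [pred n | _].
have lohi i : (lo i <= hi i)%N by case/andP: (lohip i).
have hip i : (hi i <= p)%N by case/andP: (lohip i).
have [eD e_norm e_sum] := e_p_character R p_prime.
pose c i := interval_coef R (p := p) (lo i) (hi i).
pose S (a : {ffun 'I_m -> 'F_p}) := \sum_n
  e (\sum_i a i * u n (widen_ord (leqnSn m) i)).
have countE : (#|A|%:R : R[i]) = \sum_(a : {ffun 'I_m -> 'F_p}) (\prod_i c i (a i)) * S a.
  transitivity (\sum_n \prod_(i < m) \sum_a
      c i a * e (a * u n (widen_ord (leqnSn m) i))).
    rewrite -sum1_card natr_sum big_mkcond; apply: eq_bigr => n _.
    under eq_bigr => i _ do rewrite (interval_coef_inversion R p_prime).
    rewrite inE; case: forallP => [all_in|not_all].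
      by rewrite big1 // => i _; rewrite all_in.
    apply/esym/eqP; rewrite prodf_seq_eq0; apply/hasP.
    have /existsP[i i_out] : [exists i : 'I_m,
        ~~ (lo i <= u n (widen_ord (leqnSn m) i) < hi i)%N].
      rewrite -negb_forall; apply/negP => /forallP all_in; exact: not_all.
    by exists i; rewrite ?mem_index_enum // (negPf i_out) eqxx.
  under eq_bigr => n _ do rewrite bigA_distr_bigA /=.
  rewrite exchange_big; apply: eq_bigr => a _ /=; rewrite mulr_sumr.
  apply: eq_bigr => n _; rewrite big_split /=.
  by rewrite (character_sum (e_p_character R p_prime)).
have S0 : S [ffun=> 0] = N%:R.
  rewrite /S (eq_bigr (fun=> 1)) => [|n _]; first by rewrite sumr_const card_ord.
  rewrite big1 ?(character0 (e_p_character R p_prime)) // => i _.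
  by rewrite ffunE mul0r.
have S_le a : a != [ffun=> 0] -> normc (S a) <= M.
  (* the linear form is extended by 0 to the discarded last coordinate *)
  move=> a0; pose b i := oapp a 0 (unlift ord_max i).
  have b_widen i : b (widen_ord (leqnSn m) i) = a i.
    rewrite /b (_ : widen_ord _ i = lift ord_max i) ?liftK //.
    by apply: val_inj; rewrite /= /bump leqNgt ltn_ord.
  have <- : \sum_n e (linear_form b (u n)) = S a.
    apply: eq_bigr => n _; rewrite /linear_form big_ord_recr /=.
    rewrite {2}/b unlift_none mul0r addr0.
    by congr (e _); apply: eq_bigr => i _; rewrite b_widen.
  apply: sum_le; first by rewrite /b unlift_none.
  have /existsP[i ai] : [exists i, a i != 0].
    rewrite -negb_forall; apply: contra a0 => /forallP a0.
    by apply/eqP/ffunP => i; rewrite ffunE; apply/eqP.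
  by exists (widen_ord (leqnSn m) i); rewrite b_widen.
have N_neq0 : N%:R != 0 :> R[i] by rewrite pnatr_eq0 -lt0n.
have main : (#|A|%:R / N%:R - \prod_i ((hi i - lo i)%:R / p%:R))%:C * N%:R =
    \sum_(a : {ffun 'I_m -> 'F_p} | a != [ffun=> 0]) (\prod_i c i (a i)) * S a.
  rewrite rmorphB /= mulrBl rmorphM fmorphV !rmorph_nat divfK // countE.
  rewrite (bigD1 [ffun=> 0]) //= S0.
  have -> : \prod_i c i (([ffun=> 0] : {ffun 'I_m -> 'F_p}) i) =
      (\prod_i ((hi i - lo i)%:R / p%:R))%:C.
    rewrite rmorph_prod; apply: eq_bigr => i _.
    by rewrite ffunE /c (interval_coef0 R p_prime _ (hip i)).
  by rewrite addrAC subrr add0r.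
have ln_ge0 : 0 <= 4 + 3 * ln p%:R :> R.
  by rewrite addr_ge0 // mulr_ge0 // ln_ge0 // ler1n prime_gt0.
have N_gt0' : 0 < N%:R :> R by rewrite ltr0n.
rewrite ler_pdivlMr //.
have -> : forall x : R, `|x| * N%:R = normc (x%:C * N%:R).
  by move=> x; rewrite normcM normc_nat /= expr0n addr0 sqrtr_sqr.
rewrite main; apply: le_trans (normc_sum _ _ _) _.
apply: (@le_trans _ _ (\sum_(a : {ffun 'I_m -> 'F_p})
    (\prod_i normc (c i (a i))) * M)).
  rewrite big_mkcond; apply: ler_sum => a _.
  have prod_ge0 : 0 <= \prod_i normc (c i (a i)).
    by apply: prodr_ge0 => i _; apply: normc_ge0.
  case: ifP => [a0|_]; last by rewrite mulr_ge0.
  by rewrite normcM normc_prod ler_wpM2l // S_le.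
rewrite -mulr_suml ler_wpM2r //.
rewrite -(bigA_distr_bigA (fun i a => normc (c i a))) /=.
rewrite -[X in _ ^+ X]card_ord -prodr_const; apply: ler_prod => i _.
rewrite sumr_ge0 => [|a _]; last exact: normc_ge0.
exact: sum_interval_coef.
Qed.

(** For points with coordinates in (1/p)Z a box can be replaced by one with
integer thresholds lo, hi, at the cost of 1/p in each side length. *)
Lemma local_discrepancy_le (al be : 'rV[R]_m) : unit_subbox al be ->
  local_discrepancy (fun n => scaled_point R (u n)) al be <=
  (4 + 3 * ln p%:R) ^+ m * M / N%:R + m%:R / p%:R.
Proof.
move=> ab.
have thr (v : 'rV[R]_m) : (forall i, 0 <= v 0 i) ->
    exists l : 'I_m -> nat, forall i, p%:R * v 0 i <= (l i)%:R < p%:R * v 0 i + 1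
      /\ forall k : nat, (p%:R * v 0 i <= k%:R) = (l i <= k)%N.
  move=> v_ge0; have ex i : exists l : nat, p%:R * v 0 i <= l%:R < p%:R * v 0 i + 1
      /\ forall k : nat, (p%:R * v 0 i <= k%:R) = (l <= k)%N.
    have [|l l1 l2] := @nat_threshold R (p%:R * v 0 i); last by exists l.
    by rewrite mulr_ge0 // ltW.
  by have [l lP] := choice ex; exists l.
have al_ge0 i : 0 <= al 0 i by case: (ab i).
have [lo loP] := thr al al_ge0.
have be_ge0 i : 0 <= be 0 i by case: (ab i) => a0 /(le_trans a0).
have [hi hiP] := thr be be_ge0.
have lohip i : (lo i <= hi i <= p)%N.
  have [/andP[h1 _] h2] := hiP i; have [_ l2] := loP i.
  case: (ab i) => a0 a_b b1; rewrite -l2 -h2; apply/andP; split.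
    by apply: le_trans h1; rewrite ler_pM2l.
  by rewrite ler_piMr // ltW.
rewrite /local_discrepancy.
have -> : #|[pred n | box al be (scaled_point R (u n))]| =
    #|[pred n | [forall i : 'I_m,
       (lo i <= u n (widen_ord (leqnSn m) i) < hi i)%N]]|.
  apply: eq_card => n; rewrite !inE; apply: eq_forallb => i.
  rewrite mxE; have [_ h2] := hiP i; have [_ l2] := loP i.
  rewrite -l2 ltnNge -h2 -ltNge ler_pdivlMr // ltr_pdivrMr //.
  by rewrite ![_ * p%:R]mulrC.
apply: le_trans (ler_distD (\prod_i ((hi i - lo i)%:R / p%:R)) _ _) _.
apply: lerD; first exact: box_count_error.
rewrite /box_volume.
have side i : (hi i - lo i)%:R = (hi i)%:R - (lo i)%:R :> R.
  by rewrite natrB //; case/andP: (lohip i).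
apply: prod_diff_le => i.
- rewrite side; case/andP: (lohip i) => l h; apply/andP; split.
    by rewrite divr_ge0 ?subr_ge0 ?ler_nat // ltW.
  rewrite ler_pdivrMr // mul1r lerBlDr; apply: (@le_trans _ _ p%:R).
    by rewrite ler_nat.
  by rewrite lerDl ler0n.
- case: (ab i) => a0 a_b b1; lra.
have [/andP[h1 h1'] _] := hiP i; have [/andP[l1 l1'] _] := loP i.
have -> : (hi i - lo i)%:R / p%:R - (be 0 i - al 0 i) =
   ((hi i)%:R - (lo i)%:R - (p%:R * be 0 i - p%:R * al 0 i)) / p%:R :> R.
  by rewrite side; field; rewrite gt_eqF.
rewrite normrM [`|_^-1|]gtr0_norm ?invr_gt0 // ler_pdivrMr // mulVf ?gt_eqF //.
rewrite ler_norml; apply/andP; split; lra.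
Qed.

Lemma discrepancy_le :
  discrepancy (fun n => scaled_point R (u n)) <=
  (4 + 3 * ln p%:R) ^+ m * M / N%:R + m%:R / p%:R.
Proof.
have [ne _] := has_sup_local_discrepancies (fun n => scaled_point R (u n)).
apply: ge_sup => // _ [al [be [ab ->]]].
exact: local_discrepancy_le.
Qed.

End BoxDiscrepancy.

(** * Choice of the number of shifts *)

Section Exponents.
Variables (R : realType) (m nu p : nat).
Hypotheses (m_gt0 : (0 < m)%N) (nu_gt0 : (0 < nu)%N) (p_gt1 : (1 < p)%N).

Let pR_gt1 : 1 < p%:R :> R. Proof. by rewrite ltr1n. Qed.
Let pR_gt0 : 0 < p%:R :> R. Proof. exact: lt_trans pR_gt1. Qed.
Let nuR_gt0 : 0 < nu%:R :> R. Proof. by rewrite ltr0n. Qed.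
Let mR_ge1 : 1 <= m%:R :> R. Proof. by rewrite ler1n. Qed.
Let mnu_gt0 : 0 < m%:R + nu%:R :> R.
Proof. by move: mR_ge1 nuR_gt0; lra. Qed.

(** With the first term alone the bound would be trivial, because N <= p^(m+1);
the second term is the saving. *)
Lemma alpha_expE :
  alpha_exp R m nu = (m%:R + 1) / (2 * nu%:R) - 1 / (4 * (m%:R + nu%:R)).
Proof.
rewrite /alpha_exp !(natrD, natrM).
by field; rewrite !gt_eqF.
Qed.

(** The number K of shifts is the integer part of this real number. *)
Definition shift_length : R := p%:R `^ ((2 * (m + nu))%:R^-1).

Lemma shift_length_gt0 : 0 < shift_length. Proof. exact: powR_gt0. Qed.

Lemma shift_length_ge1 : 1 <= shift_length.
Proof.
have := @ler_powR R p%:R (ltW pR_gt1) 0 (2 * (m + nu))%:R^-1.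
by rewrite powRr0; apply; rewrite invr_ge0 ler0n.
Qed.

Lemma shift_lengthX : shift_length ^+ (2 * (m + nu)) = p%:R.
Proof.
rewrite -powR_mulrn ?(ltW shift_length_gt0) // -powRrM mulVf ?powRr1 ?ler0n //.
by rewrite pnatr_eq0 muln_eq0 addn_eq0 (gtn_eqF m_gt0).
Qed.

Variable N : nat.
Hypothesis N_gt0 : (0 < N)%N.
Let NR_gt0 : 0 < N%:R :> R. Proof. by rewrite ltr0n. Qed.

Definition rate : R := p%:R `^ alpha_exp R m nu * N%:R `^ (- beta_exp R nu).

Lemma rate_gt0 : 0 < rate.
Proof. by rewrite mulr_gt0 ?powR_gt0. Qed.

Lemma rate_pow : rate ^+ (2 * nu) = p%:R ^+ m.+1 / shift_length ^+ nu / N%:R.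
Proof.
rewrite /rate exprMn -!powR_mulrn ?powR_ge0 ?ler0n // -!powRrM.
have -> : - beta_exp R nu * (2 * nu)%:R = -1.
  by rewrite /beta_exp natrM; field; rewrite gt_eqF.
rewrite powR_inv1 ?ler0n //; congr (_ / _).
have -> : alpha_exp R m nu * (2 * nu)%:R = m.+1%:R - (2 * (m + nu))%:R^-1 * nu%:R.
  rewrite alpha_expE !natrM natrD -natr1.
  by field; rewrite !gt_eqF.
rewrite powRD; last by rewrite (gt_eqF pR_gt0) implybT.
by rewrite powRN.
Qed.

Lemma rate_ge_invp : (N <= p ^ m.+1)%N -> p%:R^-1 <= rate.
Proof.
move=> Np; rewrite /rate powRN ler_pdivlMr ?powR_gt0 //.
apply: (@le_trans _ _ (p%:R^-1 * (p%:R `^ m.+1%:R) `^ beta_exp R nu)).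
  rewrite ler_wpM2l ?invr_ge0 ?ler0n // ge0_ler_powR ?nnegrE ?powR_ge0 ?ler0n //.
    by rewrite invr_ge0 mulr_ge0 ?ler0n.
  by rewrite powR_mulrn ?ler0n // -natrX ler_nat.
rewrite -powRrM -powR_inv1 ?ler0n // -powRD; last first.
  by rewrite (gt_eqF pR_gt0) implybT.
apply: ler_powR; first exact: ltW.
rewrite alpha_expE /beta_exp -natr1.
have -> : -1 + (m%:R + 1) * (2 * nu%:R)^-1 =
    (m%:R + 1) / (2 * nu%:R) - 1 :> R by rewrite addrC.
rewrite lerD2l lerN2 ler_pdivrMr ?mulr_gt0 //.
by move: mR_ge1 nuR_gt0; lra.
Qed.

Lemma shift_length_le_rate : shift_length / N%:R <= rate.
Proof.
rewrite /rate; apply: ler_pM.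
- exact: ltW shift_length_gt0.
- by rewrite invr_ge0 ler0n.
- apply: ler_powR; first exact: ltW.
  rewrite alpha_expE natrM natrD -subr_ge0.
  have -> : (m%:R + 1) / (2 * nu%:R) - 1 / (4 * (m%:R + nu%:R))
     - (2 * (m%:R + nu%:R))^-1 =
     (2 * m%:R ^+ 2 + 2 * m%:R * nu%:R + 2 * m%:R - nu%:R)
       / (4 * nu%:R * (m%:R + nu%:R)) :> R.
    by field; rewrite !gt_eqF.
  apply: divr_ge0; last by rewrite !mulr_ge0 ?ltW.
  have : nu%:R <= m%:R * nu%:R :> R by apply: ler_peMl => //; apply: ltW.
  have : 0 <= m%:R ^+ 2 :> R by rewrite sqr_ge0.
  by move: mR_ge1 nuR_gt0; lra.
rewrite powRN lef_pV2 ?posrE ?powR_gt0 //.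
apply: ler1_powR; first by rewrite ler1n.
rewrite /beta_exp invf_le1 ?mulr_gt0 //.
have : 1 <= nu%:R :> R by rewrite ler1n.
by lra.
Qed.

End Exponents.

Section OrbitSum.
Variables (R : realType) (m nu d p : nat).
Hypotheses (m_gt0 : (0 < m)%N) (nu_gt0 : (0 < nu)%N) (p_prime : prime p).
Hypothesis p_large : (maxn d nu < p)%N.
Variables (f : 'I_m.+1 -> mpolys m.+1 'F_p) (w0 : {ffun 'I_m.+1 -> 'F_p}).
Hypotheses (fd : family_degree f d) (ft : triangular_family f).
Variables (T N : nat).
Hypothesis per : purely_periodic (orbit_seq f w0) T.
Hypotheses (N_gt0 : (0 < N)%N) (NT : (N <= T)%N).
Variable a : 'I_m.+1 -> 'F_p.
Hypotheses (amax : a ord_max = 0) (a_neq0 : exists i, a i != 0).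

(** The first term counts the balanced pairs of multi-indices, the second one is
the constant in the bound for slope relations. *)
Definition moment_cst : nat := (nu ^ nu + (2 * m * m.+1 * d.+1 + d))%N.

Local Notation y := (shift_length R m nu p).
Local Notation K := (Num.truncn y).

Let p_gt1 : (1 < p)%N. Proof. exact: prime_gt1. Qed.
Let y_ge1 : 1 <= y. Proof. exact: shift_length_ge1. Qed.
Let K_gt0 : (0 < K)%N. Proof. by rewrite truncn_gt0. Qed.
Let K_le : K%:R <= y. Proof. by rewrite truncn_le; apply: le_trans y_ge1. Qed.
Let K_ge : y <= 2 * K%:R.
Proof.
have /andP[_ /ltW] := truncn_itv (le_trans ler01 y_ge1).
rewrite -natr1 => /le_trans; apply.
have : 1 <= K%:R :> R by rewrite ler1n.
by lra.
Qed.

Let K_pow : (K ^ nu.+1 <= p)%N.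
Proof.
rewrite -(ler_nat R) natrX -(shift_lengthX R nu m_gt0 p_gt1).
apply: le_trans (lerXn2r _ _ _ K_le) _; rewrite ?nnegrE ?ler0n //.
  exact: le_trans y_ge1.
by apply: ler_weXn2l => //; lia.
Qed.

Let e := e_p R (p := p).
Let z n := e (linear_form a (orbit_seq f w0 n)).
Let inner n := normc (\sum_(k < K) z (n + k)%N).

(** By the choice of K, K^(nu+1) <= p, so the pairs that are not balanced
contribute no more than the balanced ones, up to a constant. *)
Lemma orbit_moment :
  \sum_(n < N) inner n ^+ (2 * nu) <= (moment_cst * K ^ nu * p ^ m.+1)%:R.
Proof.
have card_F : #|'F_p| = p by rewrite card_Fp.
have char_large n : (0 < n <= maxn d nu)%N -> n%:R != 0 :> 'F_p.
  move=> /andP[n0 n_le]; rewrite -(dvdn_pcharf (pchar_Fp p_prime)).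
  by apply/negP => /(dvdn_leq n0); rewrite leqNgt (leq_ltn_trans n_le).
have mom := @orbit_moment_bound 'F_p R[i] e m d nu K f a
  (e_p_character R p_prime) fd ft char_large amax a_neq0.
rewrite -lecR rmorph_nat rmorph_sum.
apply: le_trans _ (le_trans mom _).
  have le_all := @sum_orbit_le _ (next_state f) w0 R[i] T N
    (fun w => `|\sum_(k < K) e (linear_form a (iter k (next_state f) w))| ^+ (2 * nu))
    per NT.
  apply: le_trans (le_all _); last by move=> w; rewrite exprn_ge0.
  apply: ler_sum => n _; rewrite rmorphXn /= -norm_normc.
  have -> : \sum_(k < K) z (n + k)%N = \sum_(k < K)
      e (linear_form a (iter k (next_state f) (iter n (next_state f) w0))).
    by apply: eq_bigr => k _; rewrite /z /orbit_seq addnC iterD.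
  exact: lexx.
rewrite ler_nat card_F /moment_cst; move: (_ + d)%N => c.
rewrite !mulnDl; apply: leq_add => //.
have -> : (K ^ (2 * nu) * (K * c * p ^ m) = c * K ^ nu * (K ^ nu.+1 * p ^ m))%N.
  by rewrite mul2n -addnn expnD expnS; ring.
rewrite [(p ^ m.+1)%N]expnS.
by rewrite leq_mul2l leq_mul2r K_pow !orbT.
Qed.

(** The power mean inequality turns the moment bound into a bound for the sum W
of the inner sums. Replacing K by its real counterpart loses a factor at most 2
in K, hence at most 2 in W. *)
Lemma orbit_sum_le :
  normc (\sum_(n < N) z n) <= (2 * moment_cst%:R + 2) * rate R m nu p N * N%:R.
Proof.
have y_gt0 : 0 < y := shift_length_gt0 R m nu p_gt1.
have KR_gt0 : 0 < K%:R :> R by rewrite ltr0n.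
have NR_gt0 : 0 < N%:R :> R by rewrite ltr0n.
have rate0 := rate_gt0 R m nu p_gt1 N_gt0.
pose W := \sum_(n < N) inner n.
have inner_ge0 n : 0 <= inner n by apply: normc_ge0.
have c_ge1 : 1 <= moment_cst%:R :> R.
  by rewrite ler1n /moment_cst addn_gt0 expn_gt0 nu_gt0.
have W_le : W <= 2 * moment_cst%:R * rate R m nu p N * K%:R * N%:R.
  have rhs_ge0 : 0 <= 2 * moment_cst%:R * rate R m nu p N * K%:R * N%:R.
    by rewrite !mulr_ge0 ?ler0n // ltW.
  rewrite -(ler_pXn2r (n := (2 * nu)%N)) ?nnegrE //; last 2 first.
  - by rewrite muln_gt0.
  - exact: sumr_ge0.
  have nu2 : (2 * nu = (2 * nu).-1.+1)%N by rewrite prednK // muln_gt0.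
  have : W ^+ (2 * nu) <= N%:R ^+ (2 * nu).-1 * \sum_(n < N) inner n ^+ (2 * nu).
    by rewrite nu2; apply: power_mean.
  move/le_trans; apply.
  apply: le_trans (ler_wpM2l _ orbit_moment) _; first by rewrite exprn_ge0 ?ler0n.
  rewrite 4!exprMn (rate_pow R m_gt0 nu_gt0 p_gt1 N) !natrM !natrX.
  have -> : N%:R ^+ (2 * nu) = N%:R * N%:R ^+ (2 * nu).-1 :> R by rewrite -exprS -nu2.
  have -> : K%:R ^+ (2 * nu) = K%:R ^+ nu * K%:R ^+ nu :> R by rewrite -exprD addnn mul2n.
  have c_pow : moment_cst%:R <= moment_cst%:R ^+ (2 * nu) :> R.
    by apply: ler_eXnr => //; rewrite muln_gt0.
  have yK : y ^+ nu <= 2 ^+ (2 * nu) * K%:R ^+ nu.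
    apply: (@le_trans _ _ (2 ^+ nu * K%:R ^+ nu)).
      by rewrite -exprMn; apply: lerXn2r K_ge; rewrite nnegrE ?mulr_ge0 // ltW.
    by rewrite ler_wpM2r ?exprn_ge0 ?ler0n // ler_weXn2l ?ler1n // leq_pmull.
  set A := N%:R ^+ (2 * nu).-1; set B := p%:R ^+ m.+1; set k := K%:R ^+ nu.
  set Cp := moment_cst%:R ^+ (2 * nu); set c := moment_cst%:R.
  have yX_gt0 : 0 < y ^+ nu by rewrite exprn_gt0.
  have -> : 2 ^+ (2 * nu) * Cp * (B / y ^+ nu / N%:R) * (k * k) * (N%:R * A) =
      A * (Cp * k * B) * ((2 ^+ (2 * nu) * k) / y ^+ nu) :> R.
    by field; rewrite !gt_eqF.
  have pos : 0 <= A * (Cp * k * B).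
    by rewrite !mulr_ge0 // exprn_ge0 ?ler0n.
  apply: (@le_trans _ _ (A * (Cp * k * B))).
    rewrite ler_wpM2l ?exprn_ge0 ?ler0n // ler_wpM2r ?exprn_ge0 ?ler0n //.
    by rewrite ler_wpM2r ?exprn_ge0 ?ler0n.
  by rewrite ler_peMr // ler_pdivlMr // mul1r.
have avg : K%:R * normc (\sum_(n < N) z n) <= W + (2 * K ^ 2)%:R.
  have := @shifted_sum_bound R[i] N K z.
  rewrite norm_normc -[(2 * K ^ 2)%:R](rmorph_nat (real_complex R)).
  rewrite -[K%:R](rmorph_nat (real_complex R)) -rmorphM.
  rewrite -(rmorph_sum (real_complex R)) -rmorphD lecR; apply=> n.
  by have [_ -> _] := e_p_character R p_prime.
have Kterm : K%:R <= rate R m nu p N * N%:R.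
  rewrite -ler_pdivrMr //; apply: le_trans (shift_length_le_rate R m_gt0 nu_gt0 p_gt1 N_gt0).
  by rewrite ler_wpM2r // invr_ge0 ltW.
rewrite -(ler_pM2l KR_gt0); apply: le_trans avg _.
have -> : K%:R * ((2 * moment_cst%:R + 2) * rate R m nu p N * N%:R) =
   2 * moment_cst%:R * rate R m nu p N * K%:R * N%:R
   + 2 * K%:R * (rate R m nu p N * N%:R) by ring.
by apply: lerD => //; rewrite natrM natrX expr2 mulrA ler_wpM2l.
Qed.

End OrbitSum.

(** * The discrepancy bound *)

Theorem theorem6 :
  forall (R : realType) (m nu d : nat),
    (1 <= m)%N -> (1 <= nu)%N -> (2 <= d)%N ->
  exists C : R,
  forall (p : nat), prime p -> (m < p)%N ->
  forall (f : 'I_m.+1 -> mpolys m.+1 'F_p),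
    family_degree f d -> triangular_family f ->
  forall (w0 : {ffun 'I_m.+1 -> 'F_p}) (T : nat),
    purely_periodic (orbit_seq f w0) T ->
  forall (N : nat), (1 <= N <= T)%N ->
    discrepancy (fun n : 'I_N => scaled_point R (orbit_seq f w0 n))
      <= C * (p%:R `^ alpha_exp R m nu) * (N%:R `^ (- beta_exp R nu))
           * ln p%:R ^+ m.
Proof.
move=> R m nu d m_gt0 nu_gt0 _.
pose p0 := maxn d nu.
(* the summand p0 covers the primes p <= p0, for which 1 <= p0 / p *)
pose c : R := 2 * (moment_cst m nu d)%:R + 2 + p0%:R.
have ln2_gt0 : 0 < ln 2 :> R by rewrite ln_gt0 // ltr1n.
(* 4 + 3 ln p <= (4 / ln 2 + 3) ln p as p is at least 2; the last term absorbs
   the rounding error m / p *)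
exists ((4 / ln 2 + 3) ^+ m * c + m%:R / ln 2 ^+ m).
move=> p p_prime _ f fd ft w0 T per N /andP[N_gt0 NT].
have p_gt1 := prime_gt1 p_prime.
have pR_gt0 : 0 < p%:R :> R by rewrite ltr0n prime_gt0.
have NR_gt0 : 0 < N%:R :> R by rewrite ltr0n.
have Np : (N <= p ^ m.+1)%N.
  apply: leq_trans NT _; have := orbit_length_le per.
  by rewrite card_ffun card_Fp // card_ord.
set Y := rate R m nu p N.
have Y_gt0 : 0 < Y by apply: rate_gt0.
have Y_ge : p%:R^-1 <= Y by apply: rate_ge_invp.
have c_ge0 : 0 <= c by rewrite !addr_ge0 ?mulr_ge0 ?ler0n.
have M_ge0 : 0 <= c * Y * N%:R by rewrite !mulr_ge0 // ltW.
have sum_le (a : 'I_m.+1 -> 'F_p) : a ord_max = 0 -> (exists i, a i != 0) ->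
    normc (\sum_(n < N) e_p R (linear_form a (orbit_seq f w0 n))) <= c * Y * N%:R.
  move=> amax a_neq0; have [p_large|p_small] := ltnP p0 p.
    apply: le_trans (orbit_sum_le R m_gt0 nu_gt0 p_prime p_large fd ft per
      N_gt0 NT amax a_neq0) _.
    by rewrite ler_wpM2r ?(ltW NR_gt0) // ler_wpM2r ?(ltW Y_gt0) // lerDl ler0n.
  apply: le_trans (normc_sum _ _ _) _.
  rewrite (eq_bigr (fun=> 1)) => [|n _]; last first.
    have [_ e_norm _] := e_p_character R p_prime.
    by apply: (@complexI R); rewrite -norm_normc e_norm.
  rewrite sumr_const card_ord -[leLHS]mul1r ler_wpM2r ?(ltW NR_gt0) //.
  apply: (@le_trans _ _ (p0%:R * Y)).
    rewrite -[leLHS](divff (lt0r_neq0 pR_gt0)); apply: ler_pM => //.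
    by rewrite ler_nat.
  rewrite ler_wpM2r ?(ltW Y_gt0) // lerDr addr_ge0 ?mulr_ge0 ?ler0n //.
apply: le_trans (discrepancy_le p_prime N_gt0 M_ge0 sum_le) _.
have lnp_ge : ln 2 <= ln p%:R :> R.
  by rewrite ler_ln ?posrE ?ltr0n ?prime_gt0 // ler_nat.
have lnp_gt0 : 0 < ln p%:R :> R by apply: lt_le_trans lnp_ge.
have lin : 4 + 3 * ln p%:R <= (4 / ln 2 + 3) * ln p%:R :> R.
  rewrite [leRHS]mulrDl lerD2r mulrAC ler_pdivlMr //.
  by rewrite ler_wpM2l.
have lin0 : 0 <= 4 + 3 * ln p%:R :> R.
  by rewrite addr_ge0 // mulr_ge0 // ltW.
rewrite -[X in _ <= X * _]mulrA -/(rate R m nu p N) -/Y.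
have -> : (4 + 3 * ln p%:R) ^+ m * (c * Y * N%:R) / N%:R =
   (4 + 3 * ln p%:R) ^+ m * c * Y by rewrite !mulrA mulfK // gt_eqF.
rewrite -[leRHS]mulrA [leRHS]mulrDl; apply: lerD.
  have -> : (4 / ln 2 + 3) ^+ m * c * (Y * ln p%:R ^+ m) =
      ((4 / ln 2 + 3) * ln p%:R) ^+ m * (c * Y) by rewrite exprMn; ring.
  rewrite -mulrA ler_wpM2r ?mulr_ge0 ?(ltW Y_gt0) //.
  by apply: lerXn2r; rewrite ?nnegrE // (le_trans lin0 lin).
have -> : m%:R / ln 2 ^+ m * (Y * ln p%:R ^+ m) = m%:R * (Y * (ln p%:R / ln 2) ^+ m).
  by rewrite expr_div_n; ring.
rewrite ler_wpM2l // (le_trans Y_ge) // ler_peMr ?(ltW Y_gt0) //.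
by apply: exprn_ege1; rewrite ler_pdivlMr // mul1r.
Qed.
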